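(* Let $t$ be any open term of $P_{\mathrm{PA}}$ (a nondeterministic probabilistic process term) and let $\sigma_1,\sigma_2$ be closed substitutions such that $\mathbf d(\sigma_1(x),\sigma_2(x))<1$ for every state variable $x$. Then \[ \mathbf d(\sigma_1(t),\sigma_2(t))\le \mathrm{da}\bigl(\llbracket t\rrbracket,\mathbf d(\sigma_1,\sigma_2)\bigr). \]
   Context: Probabilistic transition systems and bisimilarity metric. A signature $\Sigma$ is a countable set of operators $f$, each with an arity $r(f)\in\mathbb N$. Fix disjoint countably infinite sets $\mathcal V_s$ of state variables and $\mathcal V_d$ of distribution variables; $\mathcal V=\mathcal V_s\cup\mathcal V_d$. Open (state) terms are built from state variables and operators; closed terms (processes) $T(\Sigma)$ contain no variables. $\Delta(T(\Sigma))$ is the set of discrete probability distributions on $T(\Sigma)$, $\delta_t$ is the Dirac distribution at $t$, and for distributions $\pi_1,\dots,\pi_{r(f)}$, $f(\pi_1,\dots,\pi_{r(f)})$ is the distribution assigning $f(t_1,\dots,t_{r(f)})$ probability $\prod_i\pi_i(t_i)$. Distribution terms are: distribution variables $\mu$, $\delta(t)$ for state terms $t$, convex combinations $\sum_{i\in I}q_i\theta_i$ ($q_i\in(0,1]$, $\sum q_i=1$), and $f(\theta_1,\dots,\theta_{r(f)})$. A closed substitution $\sigma$ maps state variables to closed terms and distribution variables to distributions; it extends homomorphically to state terms and to distribution terms via $\sigma(\delta(t))=\delta_{\sigma(t)}$, $\sigma(\sum q_i\theta_i)=\sum q_i\sigma(\theta_i)$, $\sigma(f(\theta_1,\dots))=f(\sigma(\theta_1),\dots)$.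 A PTS is $(T(\Sigma),A,\to)$ with $A$ a countable set of actions and $\to\subseteq T(\Sigma)\times A\times\Delta(T(\Sigma))$; write $t\xrightarrow{a}\pi$, and $\mathit{der}(t,a)=\{\pi\mid t\xrightarrow a\pi\}$. A PGSOS rule has the form $\dfrac{\{x_i\xrightarrow{a_{i,m}}\mu_{i,m}\mid i\in I,m\in M_i\}\ \ \{x_i\not\xrightarrow{b_{i,n}}\mid i\in I,n\in N_i\}}{f(x_1,\dots,x_{r(f)})\xrightarrow{a}\theta}$ with $I=\{1,\dots,r(f)\}$, finite $M_i,N_i$, pairwise distinct $x_i\in\mathcal V_s$, pairwise distinct $\mu_{i,m}\in\mathcal V_d$, and $\theta$ a distribution term whose variables are among the $x_i$ and $\mu_{i,m}$. A PTSS $(\Sigma,A,R)$ with $R$ a countable set of PGSOS rules determines a unique supported model: $t\xrightarrow a\pi$ iff for some rule and closed substitution $\sigma$, $\sigma(x_i)\xrightarrow{a_{i,m}}\sigma(\mu_{i,m})$ for all positive premises, $\sigma(x_i)$ has no $b_{i,n}$-transition for all negative premises, $\sigma(f(x_1,\dots))=t$ and $\sigma(\theta)=\pi$. For $d:T(\Sigma)\times T(\Sigma)\to[0,1]$, the Kantorovich lifting is $K(d)(\pi,\pi')=\min_{\omega}\sum_{t,t'}d(t,t')\omega(t,t')$ over couplings $\omega$ of $\pi,\pi'$; the Hausdorff lifting is $H(\hat d)(\Pi_1,\Pi_2)=\max\{\sup_{\pi_1\in\Pi_1}\inf_{\pi_2\in\Pi_2}\hat d(\pi_1,\pi_2),\sup_{\pi_2\in\Pi_2}\inf_{\pi_1\in\Pi_1}\hat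 d(\pi_2,\pi_1)\}$ with $\inf\emptyset=1$, $\sup\emptyset=0$. Let $B(d)(t,t')=\sup_{a\in A}H(K(d))(\mathit{der}(t,a),\mathit{der}(t',a))$. The bisimilarity metric $\mathbf d$ is the least fixed point of $B$ on $[0,1]^{T(\Sigma)\times T(\Sigma)}$ ordered pointwise. The process algebra $P_{\mathrm{PA}}$: operators are the constant $0$, for each $a\in A$, $n\ge1$, $q_1,\dots,q_n\in(0,1]$ with $\sum q_i=1$ the $n$-ary prefix $a.\bigoplus_{i=1}^n[q_i]\_$, binary $+$, and binary $\|_B$ for each $B\subseteq A$. Rules: $a.\bigoplus_{i}[q_i]x_i\xrightarrow a\sum_i q_i\delta(x_i)$; from $x_1\xrightarrow a\mu_1$ infer $x_1+x_2\xrightarrow a\mu_1$; from $x_2\xrightarrow a\mu_2$ infer $x_1+x_2\xrightarrow a\mu_2$; for $a\in B$ from $x_1\xrightarrow a\mu_1$, $x_2\xrightarrow a\mu_2$ infer $x_1\|_Bx_2\xrightarrow a\mu_1\|_B\mu_2$; for $a\notin B$ from $x_1\xrightarrow a\mu_1$ infer $x_1\|_Bx_2\xrightarrow a\mu_1\|_B\delta(x_2)$ and from $x_2\xrightarrow a\mu_2$ infer $x_1\|_Bx_2\xrightarrow a\delta(x_1)\|_B\mu_2$. Multiplicities: $\mathcal M$ is the set of maps $m:\mathcal V\to\mathbb N\cup\{\infty\}$, ordered pointwise; $0$ is the zero map and $n_V$ ($V\subseteq\mathcal V$) maps $x\in V$ to $n$ and other variables to $0$; $1_x=1_{\{x\}}$.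 $\mathcal P$ is the set of discrete probability distributions on $\mathcal M$ (probabilistic multiplicities); $0$ and $n_V$ also denote the corresponding Dirac distributions in $\mathcal P$. For a subdistribution $\pi$ on $\mathcal M$ with mass $|\pi|$, its weighting is $\overline\pi(x)=\frac1{|\pi|}\sum_m\pi(m)m(x)$ if $|\pi|>0$, and $\overline\pi(x)=0$ otherwise. For $p_1,p_2\in\mathcal P$: $p_1\sqsubseteq p_2$ iff there is a coupling $\omega$ of $p_1,p_2$ (distribution on $\mathcal M\times\mathcal M$ with marginals $p_1,p_2$) with $\overline{\omega(\cdot,m)}\le m$ pointwise for all $m\in\mathcal M$, where $\omega(\cdot,m)$ is the subdistribution $m'\mapsto\omega(m',m)$. For $P\subseteq\mathcal P$, $\downarrow P=\{p\mid p\sqsubseteq p'\text{ for some }p'\in P\}$; $\mathcal D$ is the set of nonempty $P\subseteq\mathcal P$ with $\downarrow P=P$. The denotation $\llbracket t\rrbracket\in\mathcal D$ of an open term of $P_{\mathrm{PA}}$ is: $\llbracket0\rrbracket=\{\delta_0\}$; $\llbracket x\rrbracket=\downarrow\{\delta_{1_x}\}$; $p\in\llbracket t_1\|_Bt_2\rrbracket$ iff there are $p_1\in\llbracket t_1\rrbracket$, $p_2\in\llbracket t_2\rrbracket$ with $p\sqsubseteq p'$ where $p'(m)=\sum\{p_1(m_1)p_2(m_2)\mid m(x)=m_1(x)+m_2(x)\ \forall x\}$; $p\in\llbracket a.\bigoplus_{i=1}^n[q_i]t_i\rrbracket$ iff there are $p_i\in\llbracket t_i\rrbracket$ with $p\sqsubseteq\sum_i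 q_ip_i$; $\llbracket t_1+t_2\rrbracket=\llbracket t_1\rrbracket\cup\llbracket t_2\rrbracket$. $\mathcal E$ is the set of maps $e:\mathcal V\to[0,1)$. $\mathrm{dda}(m,e)=1-\prod_{x\in\mathcal V}(1-e(x))^{m(x)}$ (with $c^\infty=0$ for $0\le c<1$, $1^\infty=1$), $\mathrm{pda}(p,e)=\sum_m p(m)\mathrm{dda}(m,e)$, $\mathrm{da}(P,e)=\sup_{p\in P}\mathrm{pda}(p,e)$. For closed substitutions, $\mathbf d(\sigma_1,\sigma_2)\in\mathcal E$ is $x\mapsto\mathbf d(\sigma_1(x),\sigma_2(x))$. *)

(* Defs.v *)
From Stdlib Require Import Reals List Classical ClassicalEpsilon FunctionalExtensionality.
Import ListNotations.
Open Scope R_scope.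

(* Supremum of a set of reals; sup of the empty set is 0. *)
Definition Rsup (S : R -> Prop) : R :=
  match excluded_middle_informative (exists x, is_lub S x) with
  | left H => proj1_sig (constructive_indefinite_description _ H)
  | right _ => 0
  end.

(* Infimum of a set of reals; inf of the empty set is 1. *)
Definition Rinf (S : R -> Prop) : R :=
  match excluded_middle_informative (exists x, S x) with
  | left _ => - Rsup (fun y => S (- y))
  | right _ => 1
  end.

Definition sumL {X : Type} (f : X -> R) (L : list X) : R :=
  fold_right (fun x acc => f x + acc) 0 L.

Definition prodL {X : Type} (f : X -> R) (L : list X) : R :=
  fold_right (fun x acc => f x * acc) 1 L.

Definition partial_sums {X : Type} (f : X -> R) : R -> Prop :=
  fun s => exists L : list X, NoDup L /\ s = sumL f L.

(* Unordered (countable) sum of a nonnegative function: value c. *)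
Definition has_sum {X : Type} (f : X -> R) (c : R) : Prop :=
  is_lub (partial_sums f) c.

(* Unordered sum of a nonnegative function (meaningful when bounded). *)
Definition usum {X : Type} (f : X -> R) : R := Rsup (partial_sums f).

(* Extended (possibly infinite, None = +oo) unordered sum of a nonneg. function *)
Definition esum {X : Type} (f : X -> R) : option R :=
  match excluded_middle_informative (exists b, forall s, partial_sums f s -> s <= b) with
  | left _ => Some (usum f)
  | right _ => None
  end.

Definition is_dist {X : Type} (p : X -> R) : Prop :=
  (forall x, 0 <= p x) /\ has_sum p 1.

(* N u {oo}: None is oo. *)
Definition natinf := option nat.

Definition addinf (a b : natinf) : natinf :=
  match a, b with Some x, Some y => Some (x + y)%nat | _, _ => None end.

(* State variables are nat. *)
Definition mult := nat -> natinf.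

Definition mzero : mult := fun _ => Some 0%nat.
Definition mone (x : nat) : mult :=
  fun y => if Nat.eq_dec y x then Some 1%nat else Some 0%nat.

(* (sub)distributions on multiplicities *)
Definition pm := mult -> R.

Definition is_pm (p : pm) : Prop := is_dist p.

Definition diracM (m0 : mult) : pm :=
  fun m => if excluded_middle_informative (m = m0) then 1 else 0.

(* weighting of a subdistribution pi on M; values in [0,oo] (None = oo) *)
Definition weighting (pi : pm) (x : nat) : option R :=
  let mass := usum pi in
  match excluded_middle_informative (0 < mass) with
  | right _ => Some 0
  | left _ =>
      match excluded_middle_informative (exists m', 0 < pi m' /\ m' x = None) with
      | left _ => None
      | right _ =>
          match esum (fun m' => pi m' *
                        match m' x with Some k => INR k | None => 0 end) with
          | Some s => Some (s / mass)
          | None => None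
          end
      end
  end.

Definition le_ext (w : option R) (k : natinf) : Prop :=
  match k with
  | None => True
  | Some k => match w with Some r => r <= INR k | None => False end
  end.

Definition pm_le (p1 p2 : pm) : Prop :=
  is_pm p1 /\ is_pm p2 /\
  exists omega : mult * mult -> R,
    is_dist omega /\
    (forall m', has_sum (fun m => omega (m', m)) (p1 m')) /\
    (forall m, has_sum (fun m' => omega (m', m)) (p2 m)) /\
    (forall m x, le_ext (weighting (fun m' => omega (m', m)) x) (m x)).

Definition downset (P : pm -> Prop) : pm -> Prop :=
  fun p => exists p', P p' /\ pm_le p p'.

Definition pm_conv (p1 p2 : pm) : pm :=
  fun m => usum (fun mm : mult * mult =>
    if excluded_middle_informative (forall x, m x = addinf (fst mm x) (snd mm x))
    then p1 (fst mm) * p2 (snd mm) else 0).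

Definition pref_den (L : list (R * (pm -> Prop))) : pm -> Prop :=
  fun p => exists ps : list pm,
    Forall2 (fun qP p' => snd qP p') L ps /\
    pm_le p (fun m => sumL (fun qp => fst qp * snd qp m) (combine (map fst L) ps)).

Definition powinf (c : R) (k : natinf) : R :=
  match k with
  | Some n => c ^ n
  | None => if Rlt_dec c 1 then 0 else 1
  end.

(* infinite product over all state variables of factors in [0,1] *)
Definition iprod (f : nat -> R) : R :=
  Rinf (fun c => exists L : list nat, NoDup L /\ c = prodL f L).

Definition dda (m : mult) (e : nat -> R) : R :=
  1 - iprod (fun x => powinf (1 - e x) (m x)).

Definition pda (p : pm) (e : nat -> R) : R := usum (fun m => p m * dda m e).

Definition da (P : pm -> Prop) (e : nat -> R) : R :=
  Rsup (fun c => exists p, P p /\ c = pda p e).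

Section PPA.
Variable A : Type.

(* terms with variables in X; closed terms are term Empty_set *)
Inductive term (X : Type) : Type :=
| Var : X -> term X
| Nil : term X
| Pref : A -> list (R * term X) -> term X      (* a.(+)_i [q_i] t_i *)
| Sum : term X -> term X -> term X
| Par : (A -> Prop) -> term X -> term X -> term X.

Arguments Var {X}.
Arguments Nil {X}.
Arguments Pref {X}.
Arguments Sum {X}.
Arguments Par {X}.

Inductive wf {X : Type} : term X -> Prop :=
| wf_var x : wf (Var x)
| wf_nil : wf Nil
| wf_pref a l : l <> nil ->
    (forall q t, In (q, t) l -> 0 < q <= 1 /\ wf t) ->
    sumL fst l = 1 -> wf (Pref a l)
| wf_sum t1 t2 : wf t1 -> wf t2 -> wf (Sum t1 t2)
| wf_par B t1 t2 : wf t1 -> wf t2 -> wf (Par B t1 t2).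

Fixpoint subst {X Y : Type} (s : X -> term Y) (t : term X) : term Y :=
  match t with
  | Var x => s x
  | Nil => Nil
  | Pref a l => Pref a (map (fun qt => (fst qt, subst s (snd qt))) l)
  | Sum t1 t2 => Sum (subst s t1) (subst s t2)
  | Par B t1 t2 => Par B (subst s t1) (subst s t2)
  end.

Definition proc := term Empty_set.

Definition dist := proc -> R.

Definition dirac (t : proc) : dist :=
  fun s => if excluded_middle_informative (s = t) then 1 else 0.

Definition par_dist (B : A -> Prop) (p1 p2 : dist) : dist :=
  fun s => match s with
           | Par B' s1 s2 =>
               if excluded_middle_informative (B' = B) then p1 s1 * p2 s2 else 0
           | _ => 0
           end.

(* the (supported model of the) PTSS of P_PA *)
Inductive step : proc -> A -> dist -> Prop :=
| st_pref a l :
    step (Pref a l) a (fun s => sumL (fun qt => fst qt * dirac (snd qt) s) l)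
| st_suml a t1 t2 p : step t1 a p -> step (Sum t1 t2) a p
| st_sumr a t1 t2 p : step t2 a p -> step (Sum t1 t2) a p
| st_sync (B : A -> Prop) a t1 t2 p1 p2 :
    B a -> step t1 a p1 -> step t2 a p2 -> step (Par B t1 t2) a (par_dist B p1 p2)
| st_left (B : A -> Prop) a t1 t2 p1 :
    ~ B a -> step t1 a p1 -> step (Par B t1 t2) a (par_dist B p1 (dirac t2))
| st_right (B : A -> Prop) a t1 t2 p2 :
    ~ B a -> step t2 a p2 -> step (Par B t1 t2) a (par_dist B (dirac t1) p2).

Definition der (t : proc) (a : A) : dist -> Prop := fun p => step t a p.

Definition coupling (p p' : dist) (omega : proc * proc -> R) : Prop :=
  is_dist omega /\
  (forall t, has_sum (fun t' => omega (t, t')) (p t)) /\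
  (forall t', has_sum (fun t => omega (t, t')) (p' t')).

Definition Kant (d : proc -> proc -> R) (p p' : dist) : R :=
  Rinf (fun c => exists omega, coupling p p' omega /\
                   has_sum (fun tt => d (fst tt) (snd tt) * omega tt) c).

Definition Haus (dh : dist -> dist -> R) (P1 P2 : dist -> Prop) : R :=
  Rmax (Rsup (fun c => exists p1, P1 p1 /\
                 c = Rinf (fun c' => exists p2, P2 p2 /\ c' = dh p1 p2)))
       (Rsup (fun c => exists p2, P2 p2 /\
                 c = Rinf (fun c' => exists p1, P1 p1 /\ c' = dh p2 p1))).

Definition Bfun (d : proc -> proc -> R) (t t' : proc) : R :=
  Rsup (fun c => exists a : A, c = Haus (Kant d) (der t a) (der t' a)).

(* A function proc -> proc -> R represents an element of [0,1]^(T x T),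
   T = well-formed closed terms (only its values on T x T matter). *)
Definition in_unit (d : proc -> proc -> R) : Prop :=
  forall t t', wf t -> wf t' -> 0 <= d t t' <= 1.

Definition fixpoint_B (d : proc -> proc -> R) : Prop :=
  forall t t', wf t -> wf t' -> d t t' = Bfun d t t'.

Definition is_bisim_metric (d : proc -> proc -> R) : Prop :=
  in_unit d /\ fixpoint_B d /\
  forall d', in_unit d' -> fixpoint_B d' ->
    forall t t', wf t -> wf t' -> d t t' <= d' t t'.

Fixpoint denot (t : term nat) : pm -> Prop :=
  match t with
  | Var x => downset (fun p' => p' = diracM (mone x))
  | Nil => fun p => p = diracM mzero
  | Pref a l => pref_den (map (fun qt => (fst qt, denot (snd qt))) l)
  | Sum t1 t2 => fun p => denot t1 p \/ denot t2 p
  | Par B t1 t2 => fun p => exists p1 p2,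
      denot t1 p1 /\ denot t2 p2 /\ pm_le p (pm_conv p1 p2)
  end.

End PPA.

Arguments Var {A X}.
Arguments Nil {A X}.
Arguments Pref {A X}.
Arguments Sum {A X}.
Arguments Par {A X}.
Arguments wf {A X}.
Arguments subst {A X Y}.

(* Main.v *)
Require Import Defs.
From Stdlib Require Import Reals List.
From Stdlib Require Import Lra Classical ClassicalEpsilon FunctionalExtensionality FinFun.
Import ListNotations.
Open Scope R_scope.

(** The metric is compositional: the distance of sums is at most the maximum, that of
    prefixes at most the convex combination, and that of parallel compositions at most
    [x + y - x * y] for [x], [y] the distances of the components. Only the parallel case
    needs the minimality of [d]: replacing [d] by this bound on pairs of parallel
    compositions gives a pre-fixed point of the functional, because products of couplings
    couple the successors. The same three operations compute the discounted activation of
    suitably chosen elements of the denotation, and these can be taken finitely supported.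
    So, by induction on [t], the denotation has an element whose discounted activation is
    at least the distance. *)

(** * Finite sums and products over lists *)

(** Unfolding a parallel composition once is circular as an estimate: its successors are
    distributions over parallel compositions again, whose distances are the very quantity to be
    bounded. The leastness of [d] breaks this circle.

    The expression [x + y - x * y] is [1 - (1 - x) * (1 - y)]: complements multiply under a product
    of couplings, and they multiply as well when multiplicities are added, so distance and
    activation obey the same law.

    Two features of the liftings shape the estimates. The infimum of the empty set is 1, so only a
    bound below 1 guarantees a matching transition; bounds of at least 1 are settled by [d <= 1].
    Infima over transitions and couplings are approximated up to [eps], which avoids proving that
    they are attained.

    Finite support turns the sums over all multiplicities into sums over weighted lists, and such
    elements enter the denotation through reflexivity of the order. *)

Lemma sumL_app {X} (f : X -> R) L1 L2 : sumL f (L1 ++ L2) = sumL f L1 + sumL f L2.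
Proof. induction L1 as [|x L1 IH]; simpl; [lra|]. rewrite IH; lra. Qed.

Lemma sumL_map {X Y} (g : X -> Y) (f : Y -> R) L : sumL f (map g L) = sumL (fun x => f (g x)) L.
Proof. induction L as [|x L IH]; simpl; [easy|]. now rewrite IH. Qed.

Lemma sumL_ext {X} (f g : X -> R) L : (forall x, In x L -> f x = g x) -> sumL f L = sumL g L.
Proof.
  induction L as [|x L IH]; simpl; intros H; [easy|].
  rewrite IH by auto. rewrite (H x) by auto. easy.
Qed.

Lemma sumL_le {X} (f g : X -> R) L : (forall x, In x L -> f x <= g x) -> sumL f L <= sumL g L.
Proof.
  induction L as [|x L IH]; simpl; intros H; [lra|].
  specialize (IH (fun y Hy => H y (or_intror Hy))). specialize (H x (or_introl eq_refl)). lra.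
Qed.

Lemma sumL_zero {X} (L : list X) : sumL (fun _ => 0) L = 0.
Proof. induction L as [|x L IH]; simpl; [easy|]. lra. Qed.

Lemma sumL_nonneg {X} (f : X -> R) L : (forall x, In x L -> 0 <= f x) -> 0 <= sumL f L.
Proof. intros H. rewrite <- (sumL_zero L). now apply sumL_le. Qed.

Lemma sumL_plus {X} (f g : X -> R) L : sumL (fun x => f x + g x) L = sumL f L + sumL g L.
Proof. induction L as [|x L IH]; simpl; [lra|]. rewrite IH; lra. Qed.

Lemma sumL_scal {X} (f : X -> R) c L : sumL (fun x => c * f x) L = c * sumL f L.
Proof. induction L as [|x L IH]; simpl; [lra|]. rewrite IH; lra. Qed.

Lemma sumL_list_prod {X Y} (h : X * Y -> R) L1 L2 :
  sumL h (list_prod L1 L2) = sumL (fun x => sumL (fun y => h (x, y)) L2) L1.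
Proof.
  induction L1 as [|x L1 IH]; simpl; [easy|].
  now rewrite sumL_app, sumL_map, IH.
Qed.

Lemma sumL_mult {X Y} (f : X -> R) (g : Y -> R) L1 L2 :
  sumL (fun z => f (fst z) * g (snd z)) (list_prod L1 L2) = sumL f L1 * sumL g L2.
Proof.
  rewrite sumL_list_prod. cbn [fst snd]. induction L1 as [|x L1 IH]; simpl; [lra|].
  rewrite IH, sumL_scal. lra.
Qed.

Lemma sumL_incl {X} (f : X -> R) L1 L2 :
  (forall x, 0 <= f x) -> NoDup L1 -> incl L1 L2 -> sumL f L1 <= sumL f L2.
Proof.
  intros Hf HN. revert L2. induction HN as [|x L1 Hx HN IH]; intros L2 Hi.
  - simpl. now apply sumL_nonneg.
  - destruct (in_split x L2) as (l1 & l2 & ->); [apply Hi; now left|].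
    rewrite sumL_app. simpl. enough (sumL f L1 <= sumL f l1 + sumL f l2) by lra.
    rewrite <- sumL_app. apply IH. intros y Hy.
    assert (Hy' := Hi y (or_intror Hy)). apply in_app_iff in Hy'. apply in_app_iff.
    destruct Hy' as [|[->|]]; tauto.
Qed.

Lemma prodL_unit {X} (f : X -> R) L : (forall x, 0 <= f x <= 1) -> 0 <= prodL f L <= 1.
Proof. intros H. induction L as [|x L IH]; simpl; [lra|]. specialize (H x). nra. Qed.

Lemma prodL_mult {X} (f g : X -> R) L : prodL (fun x => f x * g x) L = prodL f L * prodL g L.
Proof. induction L as [|x L IH]; simpl; [lra|]. rewrite IH; lra. Qed.

Lemma prodL_app {X} (f : X -> R) L1 L2 : prodL f (L1 ++ L2) = prodL f L1 * prodL f L2.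
Proof. induction L1 as [|x L1 IH]; simpl; [lra|]. rewrite IH; lra. Qed.

Lemma prodL_incl {X} (f : X -> R) L1 L2 :
  (forall x, 0 <= f x <= 1) -> NoDup L1 -> incl L1 L2 -> prodL f L2 <= prodL f L1.
Proof.
  intros Hf HN. revert L2. induction HN as [|x L1 Hx HN IH]; intros L2 Hi.
  - simpl. now apply prodL_unit.
  - destruct (in_split x L2) as (l1 & l2 & ->); [apply Hi; now left|].
    rewrite prodL_app. simpl.
    replace (prodL f l1 * (f x * prodL f l2)) with (f x * prodL f (l1 ++ l2))
      by (rewrite prodL_app; ring).
    apply Rmult_le_compat_l; [apply Hf|]. apply IH. intros y Hy.
    assert (Hy' := Hi y (or_intror Hy)). apply in_app_iff in Hy'. apply in_app_iff.
    destruct Hy' as [|[->|]]; tauto.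
Qed.

(** Directedness of finite index sets: two partial sums, or two partial products, can be compared
    along one common list. *)
Lemma NoDup_union {X} (L1 L2 : list X) :
  exists L, NoDup L /\ incl L1 L /\ incl L2 L.
Proof.
  set (dec := fun x y : X => excluded_middle_informative (x = y)).
  exists (nodup dec (L1 ++ L2)). split; [apply NoDup_nodup|].
  split; intros x Hx; apply nodup_In, in_app_iff; auto.
Qed.

Lemma list_prod_NoDup {X Y} (L1 : list X) (L2 : list Y) :
  NoDup L1 -> NoDup L2 -> NoDup (list_prod L1 L2).
Proof.
  intros H1 H2. induction H1 as [|x L1 Hx H1 IH]; simpl; [constructor|].
  apply NoDup_app; [|easy|].
  - apply Injective_map_NoDup; [|easy]. now intros y z [= ->].
  - intros [a b] Ha Hb. apply in_map_iff in Ha as (y & [= <- <-] & _).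
    now apply in_prod_iff in Hb as [Hb _].
Qed.

(** * Suprema and infima *)

Lemma Rsup_lub S x : is_lub S x -> Rsup S = x.
Proof.
  intros H. unfold Rsup. destruct (excluded_middle_informative _) as [E|E].
  - destruct (constructive_indefinite_description _ E) as [y Hy]. simpl.
    destruct H, Hy. apply Rle_antisym; auto.
  - exfalso; eauto.
Qed.

(** [0 <= M] covers the default value 0 on the empty set. *)
Lemma Rsup_le S M : 0 <= M -> (forall x, S x -> x <= M) -> Rsup S <= M.
Proof.
  intros H0 H. unfold Rsup. destruct (excluded_middle_informative _) as [E|E]; [|easy].
  destruct (constructive_indefinite_description _ E) as [y Hy]. simpl. now apply Hy.
Qed.

(** The upper bound [M] rules out an unbounded [S], on which [Rsup] would fall back to 0. *)
Lemma le_Rsup S M x : (forall y, S y -> y <= M) -> S x -> x <= Rsup S.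
Proof.
  intros H Hx. destruct (completeness S) as [y Hy]; [now exists M|now exists x|].
  rewrite (Rsup_lub _ _ Hy). now apply Hy.
Qed.

Lemma Rsup_nonneg S : (forall x, S x -> 0 <= x) -> 0 <= Rsup S.
Proof.
  intros H. unfold Rsup. destruct (excluded_middle_informative _) as [E|E]; [|lra].
  destruct (constructive_indefinite_description _ E) as [y Hy]. simpl.
  destruct (Rle_dec 0 y) as [|Hy0]; [easy|]. exfalso.
  assert (y <= y - 1); [|lra]. apply Hy. intros z Hz.
  destruct Hy as [Hy _]. specialize (Hy z Hz). specialize (H z Hz). lra.
Qed.

Lemma Rinf_le S M x : (forall y, S y -> M <= y) -> S x -> Rinf S <= x.
Proof.
  intros H Hx. unfold Rinf. destruct (excluded_middle_informative _) as [E|E].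
  - enough (- x <= Rsup (fun y => S (- y))) by lra.
    apply le_Rsup with (- M); [|now rewrite Ropp_involutive].
    intros y Hy. specialize (H _ Hy). lra.
  - exfalso; eauto.
Qed.

Lemma le_Rinf S M : M <= 1 -> (forall x, S x -> M <= x) -> M <= Rinf S.
Proof.
  intros H1 H. unfold Rinf. destruct (excluded_middle_informative _) as [[x Hx]|E]; [|easy].
  destruct (completeness (fun y => S (- y))) as [y Hy].
  - exists (- M). intros y Hy. specialize (H _ Hy). lra.
  - exists (- x). now rewrite Ropp_involutive.
  - rewrite (Rsup_lub _ _ Hy). enough (y <= - M) by lra. apply Hy.
    intros z Hz. specialize (H _ Hz). lra.
Qed.

(** With [M <= 1], a value below [M] cannot be the default 1 of the empty set, so a witness
    exists. *)
Lemma Rinf_lt S M : M <= 1 -> Rinf S < M -> exists x, S x /\ x < M.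
Proof.
  intros H1 H. apply NNPP. intros Hn. enough (M <= Rinf S) by lra.
  apply le_Rinf; [easy|]. intros x Hx. destruct (Rle_dec M x); [easy|].
  exfalso. apply Hn. exists x. split; [easy|lra].
Qed.

(** * Unordered sums *)

Lemma has_sum_upper {X} (f : X -> R) c L : has_sum f c -> NoDup L -> sumL f L <= c.
Proof. intros [H _] HN. apply H. now exists L. Qed.

Lemma has_sum_least {X} (f : X -> R) c b :
  has_sum f c -> (forall L, NoDup L -> sumL f L <= b) -> c <= b.
Proof. intros [_ H] Hb. apply H. intros s (L & HL & ->). auto. Qed.

Lemma has_sum_intro {X} (f : X -> R) c :
  (forall L, NoDup L -> sumL f L <= c) ->
  (forall b, (forall L, NoDup L -> sumL f L <= b) -> c <= b) -> has_sum f c.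
Proof.
  intros H1 H2. split.
  - intros s (L & HL & ->). auto.
  - intros b Hb. apply H2. intros L HL. apply Hb. now exists L.
Qed.

Lemma has_sum_unique {X} (f : X -> R) a b : has_sum f a -> has_sum f b -> a = b.
Proof. intros [H1 H2] [H3 H4]. apply Rle_antisym; auto. Qed.

Lemma usum_eq {X} (f : X -> R) c : has_sum f c -> usum f = c.
Proof. apply Rsup_lub. Qed.

Lemma has_sum_nonneg {X} (f : X -> R) c : has_sum f c -> 0 <= c.
Proof. intros H. apply (has_sum_upper f c [] H). constructor. Qed.

Lemma has_sum_term {X} (f : X -> R) c x : has_sum f c -> f x <= c.
Proof.
  intros H. assert (sumL f [x] <= c) as Hx.
  { apply has_sum_upper; [easy|]. repeat constructor. easy. }
  simpl in Hx. lra.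
Qed.

Lemma has_sum_le {X} (f g : X -> R) a b :
  (forall x, f x <= g x) -> has_sum f a -> has_sum g b -> a <= b.
Proof.
  intros H Hf Hg. apply (has_sum_least f); [easy|]. intros L HL.
  apply Rle_trans with (sumL g L); [now apply sumL_le|]. now apply has_sum_upper.
Qed.

(** The source of existence for sums: the empty list makes the set of partial sums nonempty, and [b]
    bounds it, so completeness applies. *)
Lemma has_sum_dominated {X} (f g : X -> R) b :
  (forall x, f x <= g x) -> has_sum g b -> exists a, has_sum f a /\ a <= b.
Proof.
  intros H Hg.
  destruct (completeness (partial_sums f)) as [a Ha].
  - exists b. intros s (L & HL & ->).
    apply Rle_trans with (sumL g L); [now apply sumL_le|]. now apply has_sum_upper.
  - exists 0, []. split; [constructor|easy].
  - exists a. split; [easy|]. now apply (has_sum_le f g).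
Qed.

Lemma has_sum_ext {X} (f g : X -> R) a : (forall x, f x = g x) -> has_sum f a -> has_sum g a.
Proof. intros H. now replace g with f by (extensionality x; auto). Qed.

Lemma has_sum_zero {X} (f : X -> R) : (forall x, f x = 0) -> has_sum f 0.
Proof.
  intros H. apply has_sum_intro.
  - intros L _. rewrite (sumL_ext _ (fun _ => 0)) by auto. rewrite sumL_zero. lra.
  - intros b Hb. apply (Hb []). constructor.
Qed.

Lemma has_sum_plus {X} (f g : X -> R) a b :
  (forall x, 0 <= f x) -> (forall x, 0 <= g x) ->
  has_sum f a -> has_sum g b -> has_sum (fun x => f x + g x) (a + b).
Proof.
  intros Pf Pg Hf Hg. apply has_sum_intro.
  - intros L HL. rewrite sumL_plus. apply Rplus_le_compat; now apply has_sum_upper.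
  - intros c Hc. enough (a <= c - b) by lra. apply (has_sum_least f); [easy|].
    intros L1 H1. enough (b <= c - sumL f L1) by lra. apply (has_sum_least g); [easy|].
    intros L2 H2. destruct (NoDup_union L1 L2) as (L & HL & I1 & I2).
    specialize (Hc L HL). rewrite sumL_plus in Hc.
    assert (sumL f L1 <= sumL f L) by now apply sumL_incl.
    assert (sumL g L2 <= sumL g L) by now apply sumL_incl. lra.
Qed.

Lemma has_sum_scal {X} (f : X -> R) c a :
  0 <= c -> has_sum f a -> has_sum (fun x => c * f x) (c * a).
Proof.
  intros [Hc|<-] Hf.
  - apply has_sum_intro.
    + intros L HL. rewrite sumL_scal. apply Rmult_le_compat_l; [lra|]. now apply has_sum_upper.
    + intros b Hb. enough (a <= b / c).
      { apply Rmult_le_compat_l with (r := c) in H; [|lra].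
        replace (c * (b / c)) with b in H by (field; lra). easy. }
      apply (has_sum_least f); [easy|]. intros L HL. specialize (Hb L HL).
      rewrite sumL_scal in Hb. apply Rmult_le_reg_l with c; [easy|].
      replace (c * (b / c)) with b by (field; lra). easy.
  - rewrite Rmult_0_l. apply has_sum_zero. intros x. ring.
Qed.

Lemma has_sum_scal1 {X} (f : X -> R) c : 0 <= c -> has_sum f 1 -> has_sum (fun x => c * f x) c.
Proof. intros Hc Hf. assert (H := has_sum_scal f c 1 Hc Hf). now rewrite Rmult_1_r in H. Qed.

(** A finite list of pairs lies inside the rectangle of its projections, where the sum factors;
    conversely rectangles are finite lists of pairs, and their two sides are passed to the limit one
    after the other. *)
Lemma has_sum_mult {X Y} (f : X -> R) (g : Y -> R) a b :
  (forall x, 0 <= f x) -> (forall y, 0 <= g y) ->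
  has_sum f a -> has_sum g b -> has_sum (fun z => f (fst z) * g (snd z)) (a * b).
Proof.
  intros Pf Pg Hf Hg.
  assert (Ha := has_sum_nonneg _ _ Hf). assert (Hb := has_sum_nonneg _ _ Hg).
  apply has_sum_intro.
  - intros L HL.
    (* The union with the empty list removes repetitions among the projections. *)
    destruct (NoDup_union (map fst L) []) as (L1 & N1 & I1 & _).
    destruct (NoDup_union (map snd L) []) as (L2 & N2 & I2 & _).
    apply Rle_trans with (sumL f L1 * sumL g L2).
    + rewrite <- sumL_mult. apply sumL_incl; [|easy|].
      * intros z. now apply Rmult_le_pos.
      * intros [x y] Hz. apply in_prod_iff.
        split; [apply I1; now apply (in_map fst) in Hz|apply I2; now apply (in_map snd) in Hz].
    + apply Rmult_le_compat; try (now apply has_sum_upper); now apply sumL_nonneg.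
  - intros c Hc.
    assert (key : forall L1, NoDup L1 -> sumL f L1 * b <= c).
    { intros L1 N1. assert (H := has_sum_scal g (sumL f L1) b).
      apply (has_sum_least _ _ c (H ltac:(now apply sumL_nonneg) Hg)).
      intros L2 N2. rewrite sumL_scal, <- sumL_mult. apply Hc. now apply list_prod_NoDup. }
    rewrite Rmult_comm. apply (has_sum_least _ _ c (has_sum_scal f b a Hb Hf)).
    intros L1 N1. rewrite sumL_scal, Rmult_comm. auto.
Qed.

(** Reindexing along an injection outside whose image [g] vanishes. It reduces sums over parallel
    compositions to sums over pairs, and sums over a diagonal to sums over one coordinate. *)
Lemma has_sum_inj {X Y} (phi : X -> Y) (f : X -> R) (g : Y -> R) c :
  Injective phi -> (forall x, g (phi x) = f x) ->
  (forall y, (forall x, y <> phi x) -> g y = 0) -> has_sum f c -> has_sum g c.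
Proof.
  intros Hphi Hg H0 Hf. apply has_sum_intro.
  - intros L HL.
    assert (exists L', NoDup L' /\ (forall x, In x L' -> In (phi x) L) /\ sumL g L = sumL f L')
      as (L' & N' & _ & ->); [|now apply has_sum_upper].
    induction HL as [|y L Hy HL (L' & N' & I' & E')].
    + exists []. repeat split; [constructor|easy].
    + destruct (classic (exists x, y = phi x)) as [[x ->]|Hn].
      * exists (x :: L'). repeat split.
        -- constructor; auto.
        -- intros z [->|Hz]; simpl; auto.
        -- simpl. rewrite Hg, E'. easy.
      * exists L'. repeat split; [easy|simpl; auto|]. simpl. rewrite H0, E'; [lra|].
        intros x ->. eauto.
  - intros b Hb. apply (has_sum_least f); [easy|]. intros L HL.
    rewrite (sumL_ext f (fun x => g (phi x))) by easy. rewrite <- sumL_map. apply Hb.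
    now apply Injective_map_NoDup.
Qed.

(* [dirac] and [diracM] are convertible to instances of [point]. *)
Definition point {X} (x0 x : X) : R := if excluded_middle_informative (x = x0) then 1 else 0.

Lemma point_nonneg {X} (x0 x : X) : 0 <= point x0 x.
Proof. unfold point. destruct (excluded_middle_informative _); lra. Qed.

(** A sum over the one-element type, transported along the inclusion of [x0]. The sign of [h x0]
    matters because the empty list always contributes the partial sum 0. *)
Lemma has_sum_point {X} (x0 : X) h :
  0 <= h x0 -> has_sum (fun x => h x * point x0 x) (h x0).
Proof.
  intros H.
  assert (Hu : has_sum (fun _ : unit => h x0) (h x0)).
  { apply has_sum_intro.
    - intros L HL. apply Rle_trans with (sumL (fun _ : unit => h x0) [tt]).
      + apply sumL_incl; auto. intros []; simpl; auto.
      + simpl. lra.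
    - intros b Hb. specialize (Hb [tt]). simpl in Hb. rewrite Rplus_0_r in Hb. apply Hb.
      repeat constructor. easy. }
  apply (has_sum_inj (fun _ : unit => x0) (fun _ => h x0)).
  - intros [] []; easy.
  - intros _. unfold point. destruct (excluded_middle_informative _); [ring|easy].
  - intros y Hy. unfold point. destruct (excluded_middle_informative _) as [->|]; [|ring].
    now destruct (Hy tt).
  - easy.
Qed.

Lemma has_sum_point1 {X} (x0 : X) : has_sum (point x0) 1.
Proof.
  assert (H := has_sum_point x0 (fun _ => 1) ltac:(simpl; lra)). cbn beta in H.
  replace (point x0) with (fun x => 1 * point x0 x); [easy|].
  extensionality x. ring.
Qed.

Lemma has_sum_sumL {I X} (F : I -> X -> R) (c : I -> R) (l : list I) :
  (forall i, In i l -> (forall x, 0 <= F i x) /\ has_sum (F i) (c i)) ->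
  has_sum (fun x => sumL (fun i => F i x) l) (sumL c l).
Proof.
  induction l as [|i l IH]; intros H; simpl.
  - now apply has_sum_zero.
  - apply has_sum_plus.
    + apply H; now left.
    + intros x. apply sumL_nonneg. intros j Hj. apply H; now right.
    + apply H; now left.
    + apply IH. intros j Hj. apply H; now right.
Qed.

(** * The functional of the bisimilarity metric *)

(** [in_unit] and [fixpoint_B] constrain [d] on well-formed terms only, so cost estimates have to
    know that the distributions live there. *)
Definition wf_dist {A} (p : Defs.dist A) : Prop := is_dist p /\ forall s, p s <> 0 -> wf s.

Lemma par_dist_sum {A} (B : A -> Prop) (p1 p2 : Defs.dist A) c1 c2 :
  (forall s, 0 <= p1 s) -> (forall s, 0 <= p2 s) ->
  has_sum p1 c1 -> has_sum p2 c2 -> has_sum (par_dist A B p1 p2) (c1 * c2).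
Proof.
  intros N1 N2 H1 H2.
  apply (has_sum_inj (fun z : proc A * proc A => Par B (fst z) (snd z))
           (fun z => p1 (fst z) * p2 (snd z))).
  - intros [x y] [x' y']; simpl; now intros [= -> ->].
  - intros [x y]; simpl. now destruct (excluded_middle_informative (B = B)).
  - intros [ | | | |B' s1 s2] Hy; simpl; try easy.
    destruct (excluded_middle_informative (B' = B)) as [->|]; [|easy].
    now destruct (Hy (s1, s2)).
  - now apply has_sum_mult.
Qed.

Lemma par_dist_nonneg {A} (B : A -> Prop) (p1 p2 : Defs.dist A) :
  (forall s, 0 <= p1 s) -> (forall s, 0 <= p2 s) -> forall s, 0 <= par_dist A B p1 p2 s.
Proof.
  intros N1 N2 [ | | | |B' s1 s2]; simpl; try lra.
  destruct (excluded_middle_informative (B' = B)); [|lra]. now apply Rmult_le_pos.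
Qed.

Lemma wf_dist_dirac {A} (t : proc A) : wf t -> wf_dist (dirac A t).
Proof.
  intros Ht. split.
  - split; [apply point_nonneg|apply has_sum_point1].
  - intros s. unfold dirac. now destruct (excluded_middle_informative (s = t)) as [->|].
Qed.

Lemma wf_dist_par {A} (B : A -> Prop) (p1 p2 : Defs.dist A) :
  wf_dist p1 -> wf_dist p2 -> wf_dist (par_dist A B p1 p2).
Proof.
  intros [[N1 H1] W1] [[N2 H2] W2]. split; [split|].
  - now apply par_dist_nonneg.
  - rewrite <- (Rmult_1_l 1). now apply par_dist_sum.
  - intros [ | | | |B' s1 s2]; simpl; try easy.
    destruct (excluded_middle_informative (B' = B)); [|easy]. intros Hs.
    constructor; [apply W1|apply W2]; intros E; apply Hs; rewrite E; ring.
Qed.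

Lemma step_wf_dist {A} (t : proc A) a p : wf t -> step A t a p -> wf_dist p.
Proof.
  intros Ht Hs. induction Hs; inversion Ht; subst; auto using wf_dist_par, wf_dist_dirac.
  split; [split|].
  - intros s. apply sumL_nonneg. intros [q t] Hi. simpl.
    apply Rmult_le_pos; [|apply point_nonneg]. apply H2 in Hi. lra.
  - rewrite <- H3. apply has_sum_sumL. intros [q t] Hi. apply H2 in Hi as [Hq _]. simpl. split.
    + intros s. apply Rmult_le_pos; [lra|apply point_nonneg].
    + apply has_sum_scal1; [lra|apply has_sum_point1].
  - intros s Hs. apply NNPP. intros Hn. apply Hs.
    rewrite <- (sumL_zero l). apply sumL_ext. intros [q t] Hi. simpl.
    unfold dirac. destruct (excluded_middle_informative (s = t)) as [->|]; [|ring].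
    now apply H2 in Hi as [_ Hi].
Qed.

(** Each entry of a coupling is at most either of its marginals, so it vanishes where one of them
    does. *)
Lemma coupling_support {A} (p p' : Defs.dist A) om :
  wf_dist p -> wf_dist p' -> coupling A p p' om ->
  forall tt, om tt <> 0 -> wf (fst tt) /\ wf (snd tt).
Proof.
  intros [_ W] [_ W'] ([N _] & H1 & H2) [t t'] Ht. simpl. split.
  - apply W. intros E. apply Ht.
    assert (Hle := has_sum_term _ _ t' (H1 t)). simpl in Hle. specialize (N (t, t')). lra.
  - apply W'. intros E. apply Ht.
    assert (Hle := has_sum_term _ _ t (H2 t')). simpl in Hle. specialize (N (t, t')). lra.
Qed.

Lemma coupling_cost_bounds {A} d (p p' : Defs.dist A) om :
  in_unit A d -> wf_dist p -> wf_dist p' -> coupling A p p' om ->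
  forall tt, 0 <= d (fst tt) (snd tt) * om tt <= om tt.
Proof.
  intros Hd Hp Hp' Hc tt. destruct (Req_dec (om tt) 0) as [->|Ht]; [lra|].
  destruct (coupling_support _ _ _ Hp Hp' Hc tt Ht) as [W W'].
  specialize (Hd _ _ W W'). destruct Hc as ([N _] & _). specialize (N tt). nra.
Qed.

Lemma coupling_cost_mono {A} d d' (p p' : Defs.dist A) om c :
  wf_dist p -> wf_dist p' -> coupling A p p' om ->
  (forall t t', wf t -> wf t' -> d t t' <= d' t t') ->
  has_sum (fun tt => d' (fst tt) (snd tt) * om tt) c ->
  exists c', has_sum (fun tt => d (fst tt) (snd tt) * om tt) c' /\ c' <= c.
Proof.
  intros Hp Hp' Hc Hd. apply has_sum_dominated. intros tt.
  destruct (Req_dec (om tt) 0) as [->|Ht]; [lra|].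
  destruct (coupling_support _ _ _ Hp Hp' Hc tt Ht) as [W W'].
  destruct Hc as ([N _] & _). apply Rmult_le_compat_r; auto.
Qed.

Lemma coupling_cost_ex {A} d (p p' : Defs.dist A) om :
  in_unit A d -> wf_dist p -> wf_dist p' -> coupling A p p' om ->
  exists c, has_sum (fun tt => d (fst tt) (snd tt) * om tt) c /\ c <= 1.
Proof.
  intros Hd Hp Hp' Hc. apply has_sum_dominated with om; [|apply Hc].
  intros tt. now apply (coupling_cost_bounds d p p').
Qed.

Lemma product_coupling {A} (p p' : Defs.dist A) :
  is_dist p -> is_dist p' -> coupling A p p' (fun tt => p (fst tt) * p' (snd tt)).
Proof.
  intros [N H] [N' H']. split; [split|split].
  - intros tt. now apply Rmult_le_pos.
  - rewrite <- (Rmult_1_l 1). now apply has_sum_mult.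
  - intros t. simpl. now apply has_sum_scal1.
  - intros t'. simpl.
    replace (fun t => p t * p' t') with (fun t => p' t' * p t)
      by (extensionality t; ring).
    now apply has_sum_scal1.
Qed.

Lemma Kant_nonneg {A} d (p p' : Defs.dist A) : 0 <= Kant A d p p'.
Proof. apply le_Rinf; [lra|]. intros c (om & _ & Hc). now apply has_sum_nonneg in Hc. Qed.

Lemma Kant_le {A} d (p p' : Defs.dist A) om c :
  coupling A p p' om -> has_sum (fun tt => d (fst tt) (snd tt) * om tt) c ->
  Kant A d p p' <= c.
Proof.
  intros Hc Hs. apply Rinf_le with 0; [|now exists om].
  intros y (om' & _ & H). now apply has_sum_nonneg in H.
Qed.

Lemma Kant_le_1 {A} d (p p' : Defs.dist A) :
  in_unit A d -> wf_dist p -> wf_dist p' -> Kant A d p p' <= 1.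
Proof.
  intros Hd Hp Hp'. assert (Hc := product_coupling p p' (proj1 Hp) (proj1 Hp')).
  destruct (coupling_cost_ex d p p' _ Hd Hp Hp' Hc) as (c & Hs & Hle).
  apply Rle_trans with c; [|easy]. now apply Kant_le with (1 := Hc).
Qed.

(** [inf_match] and [sup_match] are the two layers of one directed half of the Hausdorff lifting. *)
Definition inf_match {A} (d : proc A -> proc A -> R) (v : proc A) (a : A) (p : Defs.dist A) : R :=
  Rinf (fun c => exists p', der A v a p' /\ c = Kant A d p p').

Definition sup_match {A} (d : proc A -> proc A -> R) (u v : proc A) (a : A) : R :=
  Rsup (fun c => exists p, der A u a p /\ c = inf_match d v a p).

Lemma Haus_sup_match {A} d (u v : proc A) a :
  Haus A (Kant A d) (der A u a) (der A v a) = Rmax (sup_match d u v a) (sup_match d v u a).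
Proof. reflexivity. Qed.

Lemma inf_match_le {A} d (v : proc A) a p p' :
  step A v a p' -> inf_match d v a p <= Kant A d p p'.
Proof.
  intros H. apply Rinf_le with 0; [|now exists p'].
  intros y (? & _ & ->). apply Kant_nonneg.
Qed.

Lemma inf_match_nonneg {A} d (v : proc A) a p : 0 <= inf_match d v a p.
Proof. apply le_Rinf; [lra|]. intros y (? & _ & ->). apply Kant_nonneg. Qed.

Lemma inf_match_le_1 {A} d (v : proc A) a p :
  in_unit A d -> wf v -> wf_dist p -> inf_match d v a p <= 1.
Proof.
  intros Hd Hv Hp. destruct (classic (exists p', step A v a p')) as [[p' H]|H].
  - apply Rle_trans with (Kant A d p p'); [now apply inf_match_le|].
    apply Kant_le_1; try easy. now apply (step_wf_dist v a).
  - unfold inf_match, Rinf. destruct (excluded_middle_informative _) as [E|E]; [|lra].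
    destruct E as (c & p' & Hs & _). exfalso. eauto.
Qed.

Lemma sup_match_nonneg {A} d (u v : proc A) a : 0 <= sup_match d u v a.
Proof. apply Rsup_nonneg. intros y (? & _ & ->). apply inf_match_nonneg. Qed.

Lemma sup_match_le_1 {A} d (u v : proc A) a :
  in_unit A d -> wf u -> wf v -> sup_match d u v a <= 1.
Proof.
  intros Hd Hu Hv. apply Rsup_le; [lra|]. intros y (p & Hs & ->).
  apply inf_match_le_1; try easy. now apply (step_wf_dist u a).
Qed.

(** Simulation up to cost [M], with slack [eps] because neither the infimum over transitions nor the
    one over couplings is assumed to be attained. For [M < 1] it is equivalent to
    [sup_match d u v a <= M] for all [a]. *)
Definition sim {A} (d : proc A -> proc A -> R) (u v : proc A) (M : R) : Prop :=
  forall a p, step A u a p -> forall eps, 0 < eps ->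
  exists p' om c, step A v a p' /\ coupling A p p' om /\
    has_sum (fun tt => d (fst tt) (snd tt) * om tt) c /\ c <= M + eps.

Lemma sup_match_intro {A} d (u v : proc A) a M :
  in_unit A d -> wf u -> wf v -> 0 <= M -> (M < 1 -> sim d u v M) -> sup_match d u v a <= M.
Proof.
  intros Hd Hu Hv H0 Hs. destruct (Rlt_dec M 1) as [H1|H1].
  - apply Rsup_le; [easy|]. intros y (p & Hp & ->). apply le_epsilon. intros eps He.
    destruct (Hs H1 a p Hp eps He) as (p' & om & c & Hp' & Hc & Hsum & Hle).
    apply Rle_trans with (Kant A d p p'); [now apply inf_match_le|].
    apply Rle_trans with c; [|easy]. now apply Kant_le with (1 := Hc).
  - assert (H := sup_match_le_1 d u v a Hd Hu Hv). lra.
Qed.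

Lemma sup_match_elim {A} d (u v : proc A) M :
  in_unit A d -> wf u -> wf v -> M < 1 ->
  (forall a, sup_match d u v a <= M) -> sim d u v M.
Proof.
  intros Hd Hu Hv H1 H a p Hp eps He.
  assert (Hi : inf_match d v a p <= sup_match d u v a).
  { apply le_Rsup with 1; [|now exists p]. intros y (p1 & Hs & ->).
    apply inf_match_le_1; try easy. now apply (step_wf_dist u a). }
  (* The threshold must exceed [M], stay within the slack, and be at most 1 so that [Rinf_lt]
     applies. It is then used for both nested infima, over transitions and over couplings. *)
  specialize (H a). set (N := Rmin 1 (M + eps)).
  assert (HN1 : N <= 1) by apply Rmin_l. assert (HN2 : N <= M + eps) by apply Rmin_r.
  assert (HN3 : M < N) by (apply Rmin_glb_lt; lra).
  assert (HN4 : inf_match d v a p < N) by lra.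
  destruct (Rinf_lt _ N HN1 HN4)
    as (x & (p' & Hp' & ->) & Hlt).
  destruct (Rinf_lt _ N HN1 Hlt) as (c & (om & Hc & Hsum) & Hlt').
  exists p', om, c. do 3 (split; [easy|]). lra.
Qed.

(** This holds even if [d] is not symmetric: the second half of [Haus] evaluates its argument at
    [dh p2 p1], so exchanging the processes merely exchanges the two halves. *)
Lemma Bfun_sym {A} d (u v : proc A) : Bfun A d u v = Bfun A d v u.
Proof.
  unfold Bfun. f_equal. extensionality c. f_equal. extensionality a.
  rewrite !Haus_sup_match, Rmax_comm. easy.
Qed.

Lemma Bfun_unit {A} d : in_unit A d -> in_unit A (Bfun A d).
Proof.
  intros Hd u v Hu Hv. split.
  - apply Rsup_nonneg. intros y (a & ->). rewrite Haus_sup_match.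
    apply Rle_trans with (2 := Rmax_l _ _). apply sup_match_nonneg.
  - apply Rsup_le; [lra|]. intros y (a & ->). rewrite Haus_sup_match.
    apply Rmax_lub; now apply sup_match_le_1.
Qed.

Lemma Bfun_intro {A} d (u v : proc A) M :
  in_unit A d -> wf u -> wf v -> 0 <= M ->
  (M < 1 -> sim d u v M /\ sim d v u M) -> Bfun A d u v <= M.
Proof.
  intros Hd Hu Hv H0 H. apply Rsup_le; [easy|]. intros y (a & ->).
  rewrite Haus_sup_match. apply Rmax_lub; apply sup_match_intro; tauto.
Qed.

Lemma Bfun_elim {A} d (u v : proc A) M :
  in_unit A d -> wf u -> wf v -> M < 1 -> Bfun A d u v <= M -> sim d u v M.
Proof.
  intros Hd Hu Hv H1 H. apply sup_match_elim; try easy. intros a.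
  apply Rle_trans with (2 := H). apply Rle_trans with (1 := Rmax_l _ (sup_match d v u a)).
  apply le_Rsup with 1; [|now exists a]. intros y (b & ->).
  rewrite Haus_sup_match. apply Rmax_lub; now apply sup_match_le_1.
Qed.

Lemma sim_mono {A} d d' (u v : proc A) M :
  wf u -> wf v -> (forall t t', wf t -> wf t' -> d t t' <= d' t t') ->
  sim d' u v M -> sim d u v M.
Proof.
  intros Hu Hv Hd H a p Hp eps He.
  destruct (H a p Hp eps He) as (p' & om & c & Hp' & Hc & Hsum & Hle).
  destruct (coupling_cost_mono d d' p p' om c) as (c' & Hs' & Hle'); try easy.
  - now apply (step_wf_dist u a).
  - now apply (step_wf_dist v a).
  - exists p', om, c'. do 3 (split; [easy|]). lra.
Qed.

Lemma Bfun_mono {A} d d' :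
  in_unit A d -> in_unit A d' -> (forall t t', wf t -> wf t' -> d t t' <= d' t t') ->
  forall u v, wf u -> wf v -> Bfun A d u v <= Bfun A d' u v.
Proof.
  intros Hd Hd' Hle u v Hu Hv. apply Bfun_intro; try easy; [now apply Bfun_unit|].
  intros H1. split; apply sim_mono with d'; try easy; apply Bfun_elim; try easy.
  rewrite Bfun_sym. lra.
Qed.

(* Knaster-Tarski: the pointwise infimum of all pre-fixed points is itself a fixed point. *)
Lemma bisim_metric_le_prefixpoint {A} d d' :
  is_bisim_metric A d -> in_unit A d' ->
  (forall u v, wf u -> wf v -> Bfun A d' u v <= d' u v) ->
  forall u v, wf u -> wf v -> d u v <= d' u v.
Proof.
  intros (_ & _ & Hleast) Hd' Hpre.
  set (pre := fun h => in_unit A h /\ forall u v, wf u -> wf v -> Bfun A h u v <= h u v).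
  set (m := fun u v => Rinf (fun x => exists h, pre h /\ x = h u v)).
  assert (Hm : forall h, pre h -> forall u v, wf u -> wf v -> m u v <= h u v).
  { intros h Hh u v Hu Hv. apply Rinf_le with 0; [|now exists h].
    intros y (h' & [Hi _] & ->). now apply Hi. }
  assert (Hpre' : pre d') by easy.
  assert (Um : in_unit A m).
  { intros u v Hu Hv. split.
    - apply le_Rinf; [lra|]. intros y (h & [Hi _] & ->). now apply Hi.
    - apply Rle_trans with (d' u v); [now apply Hm|now apply Hd']. }
  assert (Bm : forall u v, wf u -> wf v -> Bfun A m u v <= m u v).
  { intros u v Hu Hv. apply le_Rinf; [now apply Bfun_unit|]. intros y (h & Hh & ->).
    apply Rle_trans with (Bfun A h u v); [|now apply Hh].
    apply Bfun_mono; try easy; [apply Hh|]. now apply Hm. }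
  intros u v Hu Hv. apply Rle_trans with (m u v); [|now apply Hm].
  apply Hleast; try easy. intros x y Hx Hy. apply Rle_antisym; [|now apply Bm].
  (* Leastness of [d] concerns fixed points only. By monotonicity the image of [m] is again a
     pre-fixed point, hence lies above [m], which gives the missing inequality. *)
  apply Hm; try easy. split; [now apply Bfun_unit|].
  intros; apply Bfun_mono; try easy. now apply Bfun_unit.
Qed.

(** * Compositionality of the bisimilarity metric *)

Lemma bisim_metric_sym {A} d (u v : proc A) : is_bisim_metric A d -> wf u -> wf v -> d u v = d v u.
Proof. intros (_ & Hf & _) Hu Hv. rewrite (Hf u v), (Hf v u) by easy. apply Bfun_sym. Qed.

Lemma bisim_metric_sim {A} d (u v : proc A) :
  is_bisim_metric A d -> wf u -> wf v -> d u v < 1 -> sim d u v (d u v).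
Proof.
  intros (Hd & Hf & _) Hu Hv H1. apply Bfun_elim; try easy.
  rewrite <- (Hf u v) by easy. lra.
Qed.

Lemma sim_weaken {A} d (u v : proc A) M M' : M <= M' -> sim d u v M -> sim d u v M'.
Proof.
  intros HM H a p Hp eps He. destruct (H a p Hp eps He) as (p' & om & c & H1 & H2 & H3 & H4).
  exists p', om, c. do 3 (split; [easy|]). lra.
Qed.

Lemma sim_Sum {A} d (u1 u2 v1 v2 : proc A) M :
  sim d u1 v1 M -> sim d u2 v2 M -> sim d (Sum u1 u2) (Sum v1 v2) M.
Proof.
  intros S1 S2 a p Hp eps He. inversion Hp; subst.
  - destruct (S1 a p ltac:(easy) eps He) as (p' & om & c & Hs & H).
    exists p', om, c. split; [now apply st_suml|easy].
  - destruct (S2 a p ltac:(easy) eps He) as (p' & om & c & Hs & H).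
    exists p', om, c. split; [now apply st_sumr|easy].
Qed.

Lemma bisim_metric_Sum {A} d (u1 u2 v1 v2 : proc A) :
  is_bisim_metric A d -> wf u1 -> wf u2 -> wf v1 -> wf v2 ->
  d (Sum u1 u2) (Sum v1 v2) <= Rmax (d u1 v1) (d u2 v2).
Proof.
  intros HB W1 W2 W3 W4. assert (HB' := HB). destruct HB' as (Hd & Hf & _).
  set (M := Rmax (d u1 v1) (d u2 v2)).
  assert (L1 : d u1 v1 <= M) by apply Rmax_l. assert (L2 : d u2 v2 <= M) by apply Rmax_r.
  assert (E1 := bisim_metric_sym d u1 v1 HB W1 W3).
  assert (E2 := bisim_metric_sym d u2 v2 HB W2 W4).
  rewrite Hf by now constructor. apply Bfun_intro; try easy; try now constructor.
  - apply Rle_trans with (2 := L1). now apply Hd.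
  - intros HM. split; apply sim_Sum.
    + apply sim_weaken with (1 := L1), bisim_metric_sim; try easy; lra.
    + apply sim_weaken with (1 := L2), bisim_metric_sim; try easy; lra.
    + rewrite E1 in L1. apply sim_weaken with (1 := L1), bisim_metric_sim; try easy; lra.
    + rewrite E2 in L2. apply sim_weaken with (1 := L2), bisim_metric_sim; try easy; lra.
Qed.

Lemma point_pair {X Y} (x0 x : X) (y0 y : Y) :
  point (x0, y0) (x, y) = point x0 x * point y0 y.
Proof.
  unfold point.
  destruct (excluded_middle_informative (x = x0)) as [->|];
  destruct (excluded_middle_informative (y = y0)) as [->|];
  destruct (excluded_middle_informative _) as [E|E]; try ring; congruence.
Qed.

(** Both distributions are images of the weights [q], along [f] and along [g]; the coupling is their
    image along the pairing of [f] and [g]. Coinciding values of [f] or [g] need no separate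
    treatment. *)
Lemma mixture_coupling {A I} (l : list I) (q : I -> R) (f g : I -> proc A) :
  (forall i, In i l -> 0 <= q i) -> sumL q l = 1 ->
  coupling A (fun s => sumL (fun i => q i * dirac A (f i) s) l)
             (fun s => sumL (fun i => q i * dirac A (g i) s) l)
             (fun tt => sumL (fun i => q i * point (f i, g i) tt) l).
Proof.
  intros Hq H1.
  assert (N : forall i, In i l -> forall tt, 0 <= q i * point (f i, g i) tt).
  { intros i Hi tt. apply Rmult_le_pos; [auto|apply point_nonneg]. }
  split; [split|split].
  - intros tt. apply sumL_nonneg. auto.
  - rewrite <- H1. apply has_sum_sumL. intros i Hi. split; [auto|].
    apply has_sum_scal1; [auto|apply has_sum_point1].
  - intros t. apply has_sum_sumL. intros i Hi. split; [auto|].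
    apply has_sum_scal; [auto|].
    replace (fun t' => point (f i, g i) (t, t'))
      with (fun t' => point (f i) t * point (g i) t')
      by (extensionality t'; now rewrite point_pair).
    apply has_sum_scal1; [apply point_nonneg|apply has_sum_point1].
  - intros t'. apply has_sum_sumL. intros i Hi. split; [auto|].
    apply has_sum_scal; [auto|].
    replace (fun t => point (f i, g i) (t, t'))
      with (fun t => point (g i) t' * point (f i) t)
      by (extensionality t; rewrite point_pair; ring).
    apply has_sum_scal1; [apply point_nonneg|apply has_sum_point1].
Qed.

Lemma mixture_cost {A I} d (l : list I) (q : I -> R) (f g : I -> proc A) :
  (forall i, In i l -> 0 <= q i /\ 0 <= d (f i) (g i)) ->
  has_sum (fun tt => d (fst tt) (snd tt) * sumL (fun i => q i * point (f i, g i) tt) l)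
          (sumL (fun i => q i * d (f i) (g i)) l).
Proof.
  intros Hl.
  replace (fun tt => d (fst tt) (snd tt) * sumL (fun i => q i * point (f i, g i) tt) l)
    with (fun tt => sumL (fun i => q i * (d (fst tt) (snd tt) * point (f i, g i) tt)) l).
  2: { extensionality tt. rewrite <- sumL_scal. apply sumL_ext. intros; ring. }
  apply has_sum_sumL. intros i Hi. destruct (Hl i Hi) as [H1 H2].
  assert (Hp := has_sum_point (f i, g i) (fun tt => d (fst tt) (snd tt)) H2).
  split.
  - intros tt. apply Rmult_le_pos; [easy|]. unfold point.
    destruct (excluded_middle_informative _) as [->|]; simpl; lra.
  - now apply has_sum_scal.
Qed.

Lemma sim_Pref {A I} d a (l : list I) (q : I -> R) (f g : I -> proc A) :
  (forall i, In i l -> 0 <= q i /\ 0 <= d (f i) (g i)) -> sumL q l = 1 ->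
  sim d (Pref a (map (fun i => (q i, f i)) l)) (Pref a (map (fun i => (q i, g i)) l))
    (sumL (fun i => q i * d (f i) (g i)) l).
Proof.
  intros Hl H1 b p Hp eps He. inversion Hp; subst.
  exists (fun s => sumL (fun qt => fst qt * dirac A (snd qt) s) (map (fun i => (q i, g i)) l)).
  exists (fun tt => sumL (fun i => q i * point (f i, g i) tt) l).
  exists (sumL (fun i => q i * d (f i) (g i)) l).
  split; [constructor|]. split; [|split; [now apply mixture_cost|lra]].
  assert (Hc := mixture_coupling l q f g (fun i Hi => proj1 (Hl i Hi)) H1).
  replace (fun s => sumL (fun qt => fst qt * dirac A (snd qt) s) (map (fun i => (q i, f i)) l))
    with (fun s => sumL (fun i => q i * dirac A (f i) s) l)
    by (extensionality s; now rewrite sumL_map).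
  replace (fun s => sumL (fun qt => fst qt * dirac A (snd qt) s) (map (fun i => (q i, g i)) l))
    with (fun s => sumL (fun i => q i * dirac A (g i) s) l)
    by (extensionality s; now rewrite sumL_map).
  easy.
Qed.

Lemma bisim_metric_Pref {A I} d a (l : list I) (q : I -> R) (f g : I -> proc A) :
  is_bisim_metric A d ->
  l <> [] -> sumL q l = 1 -> (forall i, In i l -> 0 < q i <= 1 /\ wf (f i) /\ wf (g i)) ->
  d (Pref a (map (fun i => (q i, f i)) l)) (Pref a (map (fun i => (q i, g i)) l))
    <= sumL (fun i => q i * d (f i) (g i)) l.
Proof.
  intros HB Hne H1 Hl. assert (HB' := HB). destruct HB' as (Hd & Hf & _).
  assert (W : forall h : I -> proc A, (forall i, In i l -> wf (h i)) ->
    wf (Pref a (map (fun i => (q i, h i)) l))).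
  { intros h Hh. constructor.
    - now destruct l.
    - intros r t Hi. apply in_map_iff in Hi as (i & [= <- <-] & Hi). split; [now apply Hl|auto].
    - rewrite sumL_map. easy. }
  assert (Wf := W f ltac:(intros; now apply Hl)). assert (Wg := W g ltac:(intros; now apply Hl)).
  assert (Hnn : forall i, In i l -> 0 <= q i /\ 0 <= d (f i) (g i)).
  { intros i Hi. destruct (Hl i Hi) as (Hq & W1 & W2). split; [lra|now apply Hd]. }
  rewrite Hf by easy. apply Bfun_intro; try easy.
  - apply sumL_nonneg. intros i Hi. destruct (Hnn i Hi). now apply Rmult_le_pos.
  - intros _. split; [now apply sim_Pref|].
    rewrite (sumL_ext _ (fun i => q i * d (g i) (f i))).
    + apply sim_Pref; [|easy]. intros i Hi. split; [now apply Hnn|].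
      apply Hd; now apply Hl.
    + intros i Hi. f_equal. apply bisim_metric_sym; [easy| |]; now apply Hl.
Qed.

Lemma bisim_metric_Nil {A} d : is_bisim_metric A d -> d Nil Nil <= 0.
Proof.
  intros (Hd & Hf & _). rewrite Hf by constructor.
  assert (sim d Nil Nil 0) by (intros a p Hp; inversion Hp).
  apply Bfun_intro; try easy; constructor.
Qed.

(** The product of [h1] and [h2] with coordinates regrouped from two pairs of components to one pair
    of parallel compositions. The arguments are arbitrary functions because cost-weighted couplings
    are inserted as well. *)
Definition par_joint {A} (B : A -> Prop) (h1 h2 : proc A * proc A -> R) (tt : proc A * proc A) : R :=
  match fst tt, snd tt with
  | Par B1 s1 s2, Par B2 s1' s2' =>
      if excluded_middle_informative (B1 = B /\ B2 = B) then h1 (s1, s1') * h2 (s2, s2') else 0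
  | _, _ => 0
  end.

Lemma par_joint_nonneg {A} (B : A -> Prop) h1 h2 :
  (forall tt, 0 <= h1 tt) -> (forall tt, 0 <= h2 tt) -> forall tt, 0 <= par_joint B h1 h2 tt.
Proof.
  intros N1 N2 [[ | | | |B1 s1 s2] [ | | | |B2 s1' s2']]; unfold par_joint; simpl; try lra.
  destruct (excluded_middle_informative _); [|lra]. now apply Rmult_le_pos.
Qed.

Lemma par_joint_sum {A} (B : A -> Prop) h1 h2 c1 c2 :
  (forall tt, 0 <= h1 tt) -> (forall tt, 0 <= h2 tt) ->
  has_sum h1 c1 -> has_sum h2 c2 -> has_sum (par_joint B h1 h2) (c1 * c2).
Proof.
  intros N1 N2 H1 H2.
  apply (has_sum_inj
    (fun z : (proc A * proc A) * (proc A * proc A) =>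
       (Par B (fst (fst z)) (fst (snd z)), Par B (snd (fst z)) (snd (snd z))))
    (fun z => h1 (fst z) * h2 (snd z))).
  - intros [[x y] [z w]] [[x' y'] [z' w']]; simpl; now intros [= -> -> -> ->].
  - intros [[x y] [z w]]; unfold par_joint; simpl.
    destruct (excluded_middle_informative _); tauto.
  - intros [[ | | | |B1 s1 s2] [ | | | |B2 s1' s2']] Hy; unfold par_joint; simpl; try easy.
    destruct (excluded_middle_informative _) as [[-> ->]|]; [|easy].
    now destruct (Hy ((s1, s1'), (s2, s2'))).
  - now apply has_sum_mult.
Qed.

(** A row or column of [par_joint] at a composition over [B] is the [par_dist] of the corresponding
    rows or columns, so the marginals follow from [par_dist_sum]. *)
Lemma par_coupling {A} (B : A -> Prop) p1 p1' p2 p2' om1 om2 :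
  coupling A p1 p1' om1 -> coupling A p2 p2' om2 ->
  coupling A (par_dist A B p1 p2) (par_dist A B p1' p2') (par_joint B om1 om2).
Proof.
  intros ([N1 S1] & L1 & R1) ([N2 S2] & L2 & R2). split; [split|split].
  - now apply par_joint_nonneg.
  - rewrite <- (Rmult_1_l 1). now apply par_joint_sum.
  - intros [ | | | |B1 s1 s2]; try (apply has_sum_zero; reflexivity). simpl.
    destruct (excluded_middle_informative (B1 = B)) as [->|HB].
    + apply has_sum_ext with (par_dist A B (fun s1' => om1 (s1, s1')) (fun s2' => om2 (s2, s2')));
        [|now apply par_dist_sum].
      intros t'. unfold par_joint, par_dist. simpl. destruct t' as [ | | | |B2 s1' s2']; try easy.
      destruct (excluded_middle_informative _), (excluded_middle_informative _); tauto.
    + apply has_sum_zero. intros [ | | | |B2 s1' s2']; try easy. unfold par_joint; simpl.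
      destruct (excluded_middle_informative _); tauto.
  - intros [ | | | |B2 s1' s2'];
      try (apply has_sum_zero; intros [ | | | | ]; reflexivity). simpl.
    destruct (excluded_middle_informative (B2 = B)) as [->|HB].
    + apply has_sum_ext with (par_dist A B (fun s1 => om1 (s1, s1')) (fun s2 => om2 (s2, s2')));
        [|now apply par_dist_sum].
      intros t. unfold par_joint, par_dist. simpl. destruct t as [ | | | |B1 s1 s2]; try easy.
      destruct (excluded_middle_informative _), (excluded_middle_informative _); tauto.
    + apply has_sum_zero. intros [ | | | |B1 s1 s2]; try easy. unfold par_joint; simpl.
      destruct (excluded_middle_informative _); tauto.
Qed.

(* [1 - (1 - x) * (1 - y)], the probability that one of two independent events occurs. *)
Definition por (x y : R) : R := x + y - x * y.

Lemma por_unit x y : 0 <= x <= 1 -> 0 <= y <= 1 -> 0 <= por x y <= 1.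
Proof. unfold por. intros. nra. Qed.

Lemma por_mono x y x' y' : 0 <= x <= x' -> x' <= 1 -> 0 <= y <= y' -> y' <= 1 ->
  por x y <= por x' y'.
Proof. unfold por. intros. nra. Qed.

Lemma por_le_plus x y X Y e : 0 <= x <= 1 -> 0 <= y <= 1 -> 0 <= X <= 1 -> 0 <= Y <= 1 ->
  0 < e -> x <= X + e / 2 -> y <= Y + e / 2 -> por x y <= por X Y + e.
Proof.
  unfold por. intros.
  (* Changing one argument at a time leaves coefficients [1 - Y] and [1 - x] in [[0,1]], so each
     half of the slack is at most preserved. *)
  replace (x + y - x * y) with (X + Y - X * Y + ((1 - Y) * (x - X) + (1 - x) * (y - Y))) by ring.
  assert ((1 - Y) * (x - X) <= 1 * (e / 2)) by nra.
  assert ((1 - x) * (y - Y) <= 1 * (e / 2)) by nra. lra.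
Qed.

(* The pre-fixed point witnessing that [por] bounds the distance of parallel compositions:
   one unfolding of [||_B] reduces it to [d] on the components. *)
Definition par_bound {A} (d : proc A -> proc A -> R) (u v : proc A) : R :=
  match u, v with
  | Par B u1 u2, Par B' v1 v2 =>
      if excluded_middle_informative (B = B')
      then Rmin (d u v) (por (d u1 v1) (d u2 v2)) else d u v
  | _, _ => d u v
  end.

(** This is the purpose of the minimum in [par_bound]: together with monotonicity of the functional
    it settles every pair that is not made of two compositions over the same [B]. *)
Lemma par_bound_le {A} d (u v : proc A) : par_bound d u v <= d u v.
Proof.
  destruct u, v; simpl; try apply Rle_refl.
  destruct (excluded_middle_informative _); [apply Rmin_l|apply Rle_refl].
Qed.

Lemma par_bound_Par {A} d B (u1 u2 v1 v2 : proc A) :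
  par_bound d (Par B u1 u2) (Par B v1 v2) <= por (d u1 v1) (d u2 v2).
Proof. simpl. destruct (excluded_middle_informative _); [apply Rmin_r|easy]. Qed.

Lemma par_bound_unit {A} (d : proc A -> proc A -> R) : in_unit A d -> in_unit A (par_bound d).
Proof.
  intros Hd u v Hu Hv.
  assert (Huv := Hd u v Hu Hv). destruct u, v; simpl; try easy.
  destruct (excluded_middle_informative _); [|easy].
  inversion Hu; inversion Hv; subst.
  assert (por_u := por_unit (d u1 v1) (d u2 v2) ltac:(now apply Hd) ltac:(now apply Hd)).
  split; [apply Rmin_glb; lra|]. apply Rle_trans with (1 := Rmin_l _ _). easy.
Qed.

(** Under the product, [por x y = x * 1 + (1 - x) * y] splits the cost into two nonnegative
    products, each summed by [par_joint_sum]. The form with a subtraction would fall outside sums of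
    nonnegative functions. *)
Lemma par_bound_cost {A} d B (p1 p1' p2 p2' : Defs.dist A) om1 om2 c1 c2 :
  in_unit A d -> wf_dist p1 -> wf_dist p1' -> wf_dist p2 -> wf_dist p2' ->
  coupling A p1 p1' om1 -> coupling A p2 p2' om2 ->
  has_sum (fun tt => d (fst tt) (snd tt) * om1 tt) c1 ->
  has_sum (fun tt => d (fst tt) (snd tt) * om2 tt) c2 ->
  exists c, has_sum (fun tt => par_bound d (fst tt) (snd tt) * par_joint B om1 om2 tt) c /\
    c <= por c1 c2.
Proof.
  intros Hd W1 W1' W2 W2' C1 C2 H1 H2.
  assert (B1 := coupling_cost_bounds d p1 p1' om1 Hd W1 W1' C1).
  assert (B2 := coupling_cost_bounds d p2 p2' om2 Hd W2 W2' C2).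
  assert (P1 := coupling_support p1 p1' om1 W1 W1' C1).
  assert (P2 := coupling_support p2 p2' om2 W2 W2' C2).
  destruct C1 as ([N1 S1] & _), C2 as ([N2 S2] & _).
  set (g1 := fun tt => (1 - d (fst tt) (snd tt)) * om1 tt).
  assert (Ng : forall tt, 0 <= g1 tt) by (intros tt; specialize (B1 tt); unfold g1; lra).
  (* The sum of the complementary cost exists by domination; its value follows because cost and
     complement add up to the total mass 1. *)
  assert (Hg : has_sum g1 (1 - c1)).
  { destruct (has_sum_dominated g1 om1 1) as (c & Hc & _); [|easy|].
    - intros tt. specialize (B1 tt). unfold g1. lra.
    - replace (1 - c1) with c; [easy|].
      enough (c + c1 = 1) by lra. apply (has_sum_unique om1); [|easy].
      replace om1 with (fun tt => g1 tt + d (fst tt) (snd tt) * om1 tt)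
        by (extensionality tt; unfold g1; ring).
      apply has_sum_plus; try easy. apply B1. }
  replace (por c1 c2) with (c1 * 1 + (1 - c1) * c2) by (unfold por; ring).
  apply has_sum_dominated with (fun tt =>
    par_joint B (fun tt => d (fst tt) (snd tt) * om1 tt) om2 tt +
    par_joint B g1 (fun tt => d (fst tt) (snd tt) * om2 tt) tt).
  - intros [u v]. simpl fst; simpl snd.
    destruct u as [ | | | |B3 s1 s2]; try (unfold par_joint; simpl; lra).
    destruct v as [ | | | |B4 s1' s2']; try (unfold par_joint; simpl; lra).
    unfold par_joint. simpl fst; simpl snd. cbv iota.
    destruct (excluded_middle_informative (B3 = B /\ B4 = B)) as [[-> ->]|]; [|lra].
    assert (Hb := par_bound_Par d B s1 s2 s1' s2').
    assert (0 <= om1 (s1, s1') * om2 (s2, s2')) by now apply Rmult_le_pos.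
    apply Rle_trans with (por (d s1 s1') (d s2 s2') * (om1 (s1, s1') * om2 (s2, s2'))).
    + now apply Rmult_le_compat_r.
    + unfold g1, por. simpl. lra.
  - apply has_sum_plus; try (apply par_joint_nonneg || apply par_joint_sum); try easy;
      try apply B1; apply B2.
Qed.

(** For the interleaving rules: an idle component contributes exactly its own distance. *)
Lemma dirac_coupling {A} d (u v : proc A) :
  0 <= d u v ->
  coupling A (dirac A u) (dirac A v) (point (u, v)) /\
  has_sum (fun tt => d (fst tt) (snd tt) * point (u, v) tt) (d u v).
Proof.
  intros H. split; [|now apply (has_sum_point (u, v) (fun tt => d (fst tt) (snd tt)))].
  assert (Hc := mixture_coupling [tt] (fun _ => 1) (fun _ => u) (fun _ => v)
    ltac:(intros; lra) ltac:(simpl; lra)). simpl in Hc.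
  replace (dirac A u) with (fun s => 1 * dirac A u s + 0) by (extensionality s; ring).
  replace (dirac A v) with (fun s => 1 * dirac A v s + 0) by (extensionality s; ring).
  replace (point (u, v)) with (fun s => 1 * point (u, v) s + 0) by (extensionality s; ring).
  easy.
Qed.

Lemma sim_Par {A} d B (u1 u2 v1 v2 : proc A) :
  is_bisim_metric A d -> wf u1 -> wf u2 -> wf v1 -> wf v2 ->
  d u1 v1 < 1 -> d u2 v2 < 1 ->
  sim (par_bound d) (Par B u1 u2) (Par B v1 v2) (por (d u1 v1) (d u2 v2)).
Proof.
  intros HB Wu1 Wu2 Wv1 Wv2 L1 L2. assert (HB' := HB). destruct HB' as (Hd & _ & _).
  assert (S1 := bisim_metric_sim d u1 v1 HB Wu1 Wv1 L1).
  assert (S2 := bisim_metric_sim d u2 v2 HB Wu2 Wv2 L2).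
  assert (U1 := Hd u1 v1 Wu1 Wv1). assert (U2 := Hd u2 v2 Wu2 Wv2).
  (* The common end of all three rules. They differ only in whether a component moves or stays idle
     as a Dirac distribution; each component may use half of [eps]. *)
  assert (key : forall a p1 p1' p2 p2' om1 om2 c1 c2 eps,
    wf_dist p1 -> wf_dist p1' -> wf_dist p2 -> wf_dist p2' ->
    coupling A p1 p1' om1 -> coupling A p2 p2' om2 ->
    has_sum (fun tt => d (fst tt) (snd tt) * om1 tt) c1 ->
    has_sum (fun tt => d (fst tt) (snd tt) * om2 tt) c2 ->
    0 < eps -> c1 <= d u1 v1 + eps / 2 -> c2 <= d u2 v2 + eps / 2 ->
    step A (Par B v1 v2) a (par_dist A B p1' p2') ->
    exists p' om c, step A (Par B v1 v2) a p' /\ coupling A (par_dist A B p1 p2) p' om /\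
    has_sum (fun tt => par_bound d (fst tt) (snd tt) * om tt) c /\
    c <= por (d u1 v1) (d u2 v2) + eps).
  { intros a p1 p1' p2 p2' om1 om2 c1 c2 eps W1 W1' W2 W2' C1 C2 H1 H2 He I1 I2 Hst.
    destruct (par_bound_cost d B p1 p1' p2 p2' om1 om2 c1 c2) as (c & Hc & Hle); try easy.
    destruct (coupling_cost_ex d p1 p1' om1) as (c1' & E1 & J1); try easy.
    destruct (coupling_cost_ex d p2 p2' om2) as (c2' & E2 & J2); try easy.
    rewrite (has_sum_unique _ _ _ E1 H1) in J1. rewrite (has_sum_unique _ _ _ E2 H2) in J2.
    exists (par_dist A B p1' p2'), (par_joint B om1 om2), c.
    split; [easy|]. split; [now apply par_coupling|]. split; [easy|].
    apply Rle_trans with (1 := Hle). apply has_sum_nonneg in H1, H2.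
    now apply por_le_plus. }
  intros a p Hp eps He. assert (He2 : 0 < eps / 2) by lra.
  inversion Hp; subst.
  - destruct (S1 a p1 ltac:(easy) _ He2) as (p1' & om1 & c1 & T1 & C1 & K1 & I1).
    destruct (S2 a p2 ltac:(easy) _ He2) as (p2' & om2 & c2 & T2 & C2 & K2 & I2).
    apply (key a p1 p1' p2 p2' om1 om2 c1 c2); eauto using step_wf_dist, st_sync.
  - destruct (S1 a p1 ltac:(easy) _ He2) as (p1' & om1 & c1 & T1 & C1 & K1 & I1).
    destruct (dirac_coupling d u2 v2) as [C2 K2]; [easy|].
    apply (key a p1 p1' (dirac A u2) (dirac A v2) om1 (point (u2, v2)) c1 (d u2 v2));
      eauto using step_wf_dist, wf_dist_dirac, st_left. lra.
  - destruct (S2 a p2 ltac:(easy) _ He2) as (p2' & om2 & c2 & T2 & C2 & K2 & I2).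
    destruct (dirac_coupling d u1 v1) as [C1 K1]; [easy|].
    apply (key a (dirac A u1) (dirac A v1) p2 p2' (point (u1, v1)) om2 (d u1 v1) c2);
      eauto using step_wf_dist, wf_dist_dirac, st_right. lra.
Qed.

Lemma par_bound_prefixpoint {A} d :
  is_bisim_metric A d ->
  forall u v, wf u -> wf v -> Bfun A (par_bound d) u v <= par_bound d u v.
Proof.
  intros HB u v Hu Hv. assert (HB' := HB). destruct HB' as (Hd & Hf & _).
  assert (Hpd := par_bound_unit d Hd).
  assert (Hle : Bfun A (par_bound d) u v <= d u v).
  { rewrite (Hf u v) by easy. apply Bfun_mono; try easy. intros; apply par_bound_le. }
  destruct u as [ | | | |B u1 u2], v as [ | | | |B' v1 v2]; try easy.
  simpl. destruct (excluded_middle_informative (B = B')) as [<-|]; [|easy].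
  apply Rmin_glb; [easy|].
  inversion Hu; inversion Hv; subst.
  assert (U1 := Hd u1 v1 ltac:(easy) ltac:(easy)).
  assert (U2 := Hd u2 v2 ltac:(easy) ltac:(easy)).
  apply Bfun_intro; try easy; [now apply por_unit|].
  (* The complement of [por] is a product of nonnegative factors, so it is positive only if both
     factors are. Hence both components have matching transitions. *)
  intros HM. assert (d u1 v1 < 1 /\ d u2 v2 < 1) as [L1 L2] by (unfold por in HM; nra).
  split; [now apply sim_Par|].
  rewrite (bisim_metric_sym d u1 v1), (bisim_metric_sym d u2 v2) by easy.
  apply sim_Par; try easy;
    [rewrite (bisim_metric_sym d v1 u1)|rewrite (bisim_metric_sym d v2 u2)]; easy.
Qed.

Lemma bisim_metric_Par {A} d B (u1 u2 v1 v2 : proc A) :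
  is_bisim_metric A d -> wf u1 -> wf u2 -> wf v1 -> wf v2 ->
  d (Par B u1 u2) (Par B v1 v2) <= por (d u1 v1) (d u2 v2).
Proof.
  intros HB Wu1 Wu2 Wv1 Wv2.
  apply Rle_trans with (2 := par_bound_Par d B u1 u2 v1 v2).
  apply bisim_metric_le_prefixpoint; try easy; try now constructor.
  - apply par_bound_unit, HB.
  - now apply par_bound_prefixpoint.
Qed.

(** * Discounted activation of multiplicities *)

Lemma iprod_unit f : (forall x, 0 <= f x <= 1) -> 0 <= iprod f <= 1.
Proof.
  intros Hf. split.
  - apply le_Rinf; [lra|]. intros y (L & _ & ->). now apply prodL_unit.
  - apply Rinf_le with 0.
    + intros y (L & _ & ->). now apply prodL_unit.
    + exists []. split; [constructor|easy].
Qed.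

Lemma iprod_le f L : (forall x, 0 <= f x <= 1) -> NoDup L -> iprod f <= prodL f L.
Proof.
  intros Hf HL. apply Rinf_le with 0; [|now exists L].
  intros y (L' & _ & ->). now apply prodL_unit.
Qed.

Lemma le_iprod f c : (forall x, 0 <= f x <= 1) ->
  (forall L, NoDup L -> c <= prodL f L) -> c <= iprod f.
Proof.
  intros Hf H. apply le_Rinf.
  - apply (H []). constructor.
  - intros y (L & HL & ->). auto.
Qed.

(** Partial products decrease as the list grows, so those of [f] and [g] over different lists are
    both bounded below along a common list; the converse holds list by list. *)
Lemma iprod_mult f g : (forall x, 0 <= f x <= 1) -> (forall x, 0 <= g x <= 1) ->
  iprod (fun x => f x * g x) = iprod f * iprod g.
Proof.
  intros Hf Hg.
  assert (Hfg : forall x, 0 <= f x * g x <= 1) by (intros x; specialize (Hf x); specialize (Hg x); nra).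
  assert (Uf := iprod_unit f Hf). assert (Ug := iprod_unit g Hg).
  apply Rle_antisym.
  - assert (H : forall L1 L2, NoDup L1 -> NoDup L2 ->
      iprod (fun x => f x * g x) <= prodL f L1 * prodL g L2).
    { intros L1 L2 N1 N2. destruct (NoDup_union L1 L2) as (L & HL & I1 & I2).
      apply Rle_trans with (1 := iprod_le _ L Hfg HL). rewrite prodL_mult.
      apply Rmult_le_compat; try now apply prodL_unit.
      - now apply prodL_incl.
      - now apply prodL_incl. }
    (* The two infima are formed one after the other, dividing by the factor held fixed; a zero
       factor is treated apart. *)
    apply Rnot_lt_le. intros Hlt. set (c := iprod (fun x => f x * g x)) in *.
    assert (H1 : forall L1, NoDup L1 -> c <= prodL f L1 * iprod g).
    { intros L1 N1. destruct (prodL_unit f L1 Hf) as [P1 P2].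
      destruct P1 as [P1|P1].
      - enough (c / prodL f L1 <= iprod g).
        { apply Rmult_le_compat_l with (r := prodL f L1) in H0; [|lra].
          replace (prodL f L1 * (c / prodL f L1)) with c in H0 by (field; lra). easy. }
        apply le_iprod; [easy|]. intros L2 N2. specialize (H L1 L2 N1 N2).
        apply Rmult_le_reg_l with (prodL f L1); [easy|].
        replace (prodL f L1 * (c / prodL f L1)) with c by (field; lra). easy.
      - specialize (H L1 [] N1 ltac:(constructor)). simpl in H. rewrite <- P1 in *. lra. }
    destruct Ug as [[P1|P1] P2].
    + assert (c / iprod g <= iprod f).
      { apply le_iprod; [easy|]. intros L1 N1. specialize (H1 L1 N1).
        apply Rmult_le_reg_r with (iprod g); [easy|].
        replace (c / iprod g * iprod g) with c by (field; lra). easy. }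
      apply Rmult_le_compat_r with (r := iprod g) in H0; [|lra].
      replace (c / iprod g * iprod g) with c in H0 by (field; lra). lra.
    + specialize (H1 [] ltac:(constructor)). simpl in H1. rewrite <- P1 in *. lra.
  - apply le_iprod; [easy|]. intros L HL. rewrite prodL_mult.
    apply Rmult_le_compat; try easy; now apply iprod_le.
Qed.

Lemma prodL_one {X} (f : X -> R) L : (forall x, In x L -> f x = 1) -> prodL f L = 1.
Proof.
  induction L as [|x L IH]; simpl; intros H; [easy|]. rewrite (H x), IH by auto. ring.
Qed.

Lemma iprod_single f x : (forall y, 0 <= f y <= 1) -> (forall y, y <> x -> f y = 1) ->
  iprod f = f x.
Proof.
  intros Hf H1. apply Rle_antisym.
  - replace (f x) with (prodL f [x]) by (simpl; ring).
    apply iprod_le; [easy|]. repeat constructor. easy.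
  - apply le_iprod; [easy|]. intros L HL. induction HL as [|y L Hy HL IH]; simpl; [apply Hf|].
    destruct (Nat.eq_dec y x) as [->|Hne].
    + rewrite (prodL_one f L); [lra|]. intros z Hz. apply H1. now intros ->.
    + rewrite (H1 y Hne). lra.
Qed.

Lemma powinf_unit c k : 0 <= c <= 1 -> 0 <= powinf c k <= 1.
Proof.
  intros Hc. destruct k as [n|]; simpl.
  - induction n as [|n IH]; simpl; [lra|nra].
  - destruct (Rlt_dec c 1); lra.
Qed.

Lemma powinf_add c a b : 0 <= c <= 1 -> powinf c (addinf a b) = powinf c a * powinf c b.
Proof.
  intros Hc. destruct a as [n|], b as [k|]; simpl; try apply pow_add;
    destruct (Rlt_dec c 1); try ring; replace c with 1 by lra; rewrite pow1; ring.
Qed.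

Definition unit_valued (e : nat -> R) : Prop := forall x, 0 <= e x <= 1.

Lemma powinf_compl_unit e m : unit_valued e -> forall x, 0 <= powinf (1 - e x) (m x) <= 1.
Proof. intros He x. apply powinf_unit. specialize (He x). lra. Qed.

Lemma dda_unit m e : unit_valued e -> 0 <= dda m e <= 1.
Proof.
  intros He. unfold dda. assert (H := iprod_unit _ (powinf_compl_unit e m He)). lra.
Qed.

Lemma dda_mone x e : unit_valued e -> dda (mone x) e = e x.
Proof.
  intros He. unfold dda. rewrite (iprod_single _ x).
  - unfold mone. destruct (Nat.eq_dec x x); [|easy]. simpl. ring.
  - now apply powinf_compl_unit.
  - intros y Hy. unfold mone. now destruct (Nat.eq_dec y x).
Qed.

Definition addm (m1 m2 : mult) : mult := fun x => addinf (m1 x) (m2 x).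

(** Adding exponents multiplies the products that [dda] subtracts from 1, which yields the same
    operation [por] as for distances. *)
Lemma dda_addm m1 m2 e : unit_valued e -> dda (addm m1 m2) e = por (dda m1 e) (dda m2 e).
Proof.
  intros He. unfold dda, por.
  replace (iprod (fun x => powinf (1 - e x) (addm m1 m2 x)))
    with (iprod (fun x => powinf (1 - e x) (m1 x) * powinf (1 - e x) (m2 x))).
  - rewrite iprod_mult by now apply powinf_compl_unit. ring.
  - f_equal. extensionality x. unfold addm. rewrite powinf_add; [easy|].
    specialize (He x). lra.
Qed.

Lemma pda_le_1 p e : unit_valued e -> is_pm p -> pda p e <= 1.
Proof.
  intros He [Hp Hs]. apply Rsup_le; [lra|]. intros y (L & HL & ->).
  apply Rle_trans with (sumL p L); [|now apply has_sum_upper].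
  apply sumL_le. intros m _. assert (H := dda_unit m e He). specialize (Hp m). nra.
Qed.

(** * Finitely supported probabilistic multiplicities *)

(** A multiplicity may occur several times in the list, so convolution and convex combination become
    plain list operations without merging of equal entries. *)
Definition mix (l : list (R * mult)) : pm := fun m => sumL (fun wm => fst wm * point (snd wm) m) l.

Definition convex (l : list (R * mult)) : Prop :=
  (forall wm, In wm l -> 0 <= fst wm) /\ sumL fst l = 1.

Definition mix_da (l : list (R * mult)) (e : nat -> R) : R :=
  sumL (fun wm => fst wm * dda (snd wm) e) l.

Lemma is_pm_mix l : convex l -> is_pm (mix l).
Proof.
  intros [Hw H1].
  assert (N : forall wm, In wm l -> forall m, 0 <= fst wm * point (snd wm) m).
  { intros wm Hi m. apply Rmult_le_pos; [auto|apply point_nonneg]. }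
  split.
  - intros m. apply sumL_nonneg. auto.
  - rewrite <- H1. apply has_sum_sumL. intros wm Hi. split; [auto|].
    apply has_sum_scal1; [auto|apply has_sum_point1].
Qed.

Lemma pda_mix l e : unit_valued e -> convex l -> pda (mix l) e = mix_da l e.
Proof.
  intros He [Hw _]. apply usum_eq.
  apply has_sum_ext with (fun m => sumL (fun wm => fst wm * (dda m e * point (snd wm) m)) l).
  - intros m. unfold mix. rewrite Rmult_comm, <- sumL_scal. apply sumL_ext. intros; ring.
  - apply has_sum_sumL. intros wm Hi. assert (Hd := fun m => dda_unit m e He). split.
    + intros m. apply Rmult_le_pos; [auto|]. apply Rmult_le_pos; [apply Hd|apply point_nonneg].
    + apply has_sum_scal; [auto|]. apply (has_sum_point (snd wm) (fun m => dda m e)). apply Hd.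
Qed.

Lemma diracM_mix m : diracM m = mix [(1, m)].
Proof. extensionality m'. unfold mix. simpl. unfold diracM, point. ring. Qed.

Lemma convex_single m : convex [(1, m)].
Proof. split; [|simpl; ring]. intros wm [<-|[]]. simpl. lra. Qed.

Definition mix_par (l1 l2 : list (R * mult)) : list (R * mult) :=
  map (fun z => (fst (fst z) * fst (snd z), addm (snd (fst z)) (snd (snd z)))) (list_prod l1 l2).

Lemma convex_mix_par l1 l2 : convex l1 -> convex l2 -> convex (mix_par l1 l2).
Proof.
  intros [W1 S1] [W2 S2]. split.
  - intros wm Hi. apply in_map_iff in Hi as ([z1 z2] & <- & Hz). simpl.
    apply in_prod_iff in Hz as [H1 H2]. apply Rmult_le_pos; auto.
  - unfold mix_par. rewrite sumL_map. simpl. rewrite sumL_mult, S1, S2. ring.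
Qed.

Lemma mix_da_par l1 l2 e : unit_valued e -> convex l1 -> convex l2 ->
  mix_da (mix_par l1 l2) e = por (mix_da l1 e) (mix_da l2 e).
Proof.
  intros He [W1 S1] [W2 S2].
  (* Passing to complements makes the claim multiplicative, so that the double sum over the product
     list factors. *)
  assert (C : forall l, sumL fst l = 1 ->
    sumL (fun wm => fst wm * (1 - dda (snd wm) e)) l = 1 - mix_da l e).
  { intros l Hl. enough (sumL (fun wm => fst wm * (1 - dda (snd wm) e)) l + mix_da l e = 1) by lra.
    unfold mix_da. rewrite <- sumL_plus. transitivity (sumL fst l); [|easy].
    apply sumL_ext. intros; ring. }
  assert (Hp : convex (mix_par l1 l2)) by now apply convex_mix_par.
  enough (1 - mix_da (mix_par l1 l2) e = (1 - mix_da l1 e) * (1 - mix_da l2 e))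
    by (unfold por; lra).
  rewrite <- C by apply Hp. rewrite <- (C l1), <- (C l2) by easy. rewrite <- sumL_mult.
  unfold mix_par. rewrite sumL_map. apply sumL_ext. intros [[w1 m1] [w2 m2]] _. simpl.
  rewrite dda_addm by easy. unfold por. ring.
Qed.

Lemma pm_conv_mix l1 l2 : convex l1 -> convex l2 ->
  pm_conv (mix l1) (mix l2) = mix (mix_par l1 l2).
Proof.
  intros [W1 _] [W2 _]. extensionality m. apply usum_eq.
  (* The condition in [pm_conv] as an indicator function of the pair, integrated against the point
     masses of the product list. *)
  set (h := fun mm : mult * mult => point (addm (fst mm) (snd mm)) m).
  unfold mix at 3, mix_par. rewrite sumL_map. simpl.
  apply has_sum_ext with (fun mm => sumL (fun z => (fst (fst z) * fst (snd z)) *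
    (h mm * point (snd (fst z), snd (snd z)) mm)) (list_prod l1 l2)).
  - intros [m1 m2]. simpl.
    transitivity (h (m1, m2) * (mix l1 m1 * mix l2 m2)).
    + unfold mix. rewrite <- sumL_mult, <- sumL_scal. apply sumL_ext.
      intros [[w1 k1] [w2 k2]] _. simpl. rewrite point_pair. ring.
    + unfold h, point, addm. simpl.
      destruct (excluded_middle_informative (m = _)) as [->|Hn];
      destruct (excluded_middle_informative (forall x, _)) as [E|E]; try ring; exfalso.
      * now apply E.
      * apply Hn. extensionality x. apply E.
  - apply has_sum_sumL. intros [[w1 k1] [w2 k2]] Hi. simpl.
    apply in_prod_iff in Hi as [H1 H2].
    assert (0 <= w1 * w2) by (apply Rmult_le_pos; [now apply (W1 (w1, k1))|now apply (W2 (w2, k2))]).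
    split.
    + intros mm. apply Rmult_le_pos; [easy|]. apply Rmult_le_pos; apply point_nonneg.
    + apply has_sum_scal; [easy|]. apply (has_sum_point (k1, k2) h). apply point_nonneg.
Qed.

(** A subdistribution concentrated at [m] has weighting [m] if its mass is positive and 0 otherwise.
    These are the columns of the diagonal coupling in [pm_le_refl]. *)
Lemma weighting_concentrated (p : pm) m x :
  (forall m', 0 <= p m') -> le_ext (weighting (fun m' => p m * point m m') x) (m x).
Proof.
  intros Hp. unfold le_ext. destruct (m x) as [k|] eqn:Ek; [|easy].
  unfold weighting.
  rewrite (usum_eq _ (p m) (has_sum_scal1 (point m) (p m) (Hp m) (has_sum_point1 m))).
  destruct (excluded_middle_informative (0 < p m)) as [H0|]; [|apply pos_INR].
  destruct (excluded_middle_informative _) as [(m' & H1 & H2)|_].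
  - unfold point in H1. destruct (excluded_middle_informative (m' = m)) as [->|]; [|lra].
    congruence.
  - set (f := fun m' : mult => p m * point m m' * match m' x with Some k => INR k | None => 0 end).
    assert (Hf : has_sum f (p m * INR k)).
    { set (h := fun m' : mult => match m' x with Some k => INR k | None => 0 end).
      assert (Hh : h m = INR k) by (unfold h; now rewrite Ek).
      apply has_sum_ext with (fun m' => p m * (h m' * point m m')).
      - intros m'. unfold f, h. ring.
      - rewrite <- Hh. apply has_sum_scal; [easy|]. apply has_sum_point.
        rewrite Hh. apply pos_INR. }
    unfold esum. destruct (excluded_middle_informative _) as [_|E].
    + rewrite (usum_eq _ _ Hf). apply Req_le. field. lra.
    + apply E. exists (p m * INR k). apply Hf.
Qed.

Lemma pm_le_refl p : is_pm p -> pm_le p p.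
Proof.
  intros Hp. split; [easy|]. split; [easy|]. destruct Hp as [Hp Hs].
  exists (fun z => p (snd z) * point (snd z) (fst z)).
  split; [split|split; [|split]].
  - intros z. apply Rmult_le_pos; [easy|apply point_nonneg].
  - apply (has_sum_inj (fun m : mult => (m, m)) p); try easy.
    + now intros x y [= ->].
    + intros m. simpl. unfold point. destruct (excluded_middle_informative _); [ring|easy].
    + intros [m m'] Hy. simpl. unfold point.
      destruct (excluded_middle_informative _) as [->|]; [|ring]. now destruct (Hy m').
  - intros m'. simpl. apply has_sum_ext with (fun m => p m * point m' m).
    + intros m. unfold point.
      destruct (excluded_middle_informative (m = m')), (excluded_middle_informative (m' = m));
        try ring; congruence.
    + now apply has_sum_point.
  - intros m. simpl. apply has_sum_scal1; [easy|apply has_sum_point1].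
  - intros m x. simpl. now apply weighting_concentrated.
Qed.

(** * The denotation of a term dominates the distance of its instances *)

(** The generated principle gives no hypothesis for the terms nested in the list of a prefix. *)
Lemma term_list_ind {A X} (P : term A X -> Prop) :
  (forall x, P (Var x)) -> P Nil ->
  (forall a l, (forall q t, In (q, t) l -> P t) -> P (Pref a l)) ->
  (forall t1 t2, P t1 -> P t2 -> P (Sum t1 t2)) ->
  (forall B t1 t2, P t1 -> P t2 -> P (Par B t1 t2)) ->
  forall t, P t.
Proof.
  intros HV HN HP HS HB. fix IH 1. intros [x| |a l|t1 t2|B t1 t2].
  - apply HV.
  - apply HN.
  - apply HP. induction l as [|[q' t'] l IHl]; intros q t Hi; [destruct Hi|].
    destruct Hi as [E|Hi]; [|now apply (IHl q)].
    (* Rewriting towards [t'], a syntactic subterm, keeps the recursive call guarded. *)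
    assert (E' := f_equal snd E). simpl in E'. rewrite <- E'. apply IH.
  - apply HS; apply IH.
  - apply HB; apply IH.
Qed.

Lemma wf_subst {A X Y} (s : X -> term A Y) t : (forall x, wf (s x)) -> wf t -> wf (subst s t).
Proof.
  intros Hs. induction t as [x| |a l IH|t1 t2 IH1 IH2|B t1 t2 IH1 IH2] using term_list_ind;
    intros Ht; inversion Ht; subst; simpl; try (constructor; auto; fail); auto.
  constructor.
  - now destruct l.
  - intros q t Hi. apply in_map_iff in Hi as ([q' t'] & [= <- <-] & Hi). simpl.
    split; [now apply (H2 q' t')|]. apply (IH q' t' Hi). now apply (H2 q' t').
  - now rewrite sumL_map.
Qed.

Lemma denot_is_pm {A} (t : term A nat) p : denot A t p -> is_pm p.
Proof.
  revert p. induction t as [x| |a l|t1 IH1 t2 IH2|B t1 _ t2 _]; simpl; intros p Hp.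
  - now destruct Hp as (p' & _ & Hp & _).
  - subst p. rewrite diracM_mix. apply is_pm_mix, convex_single.
  - now destruct Hp as (ps & _ & Hp & _).
  - destruct Hp; auto.
  - now destruct Hp as (p1 & p2 & _ & _ & Hp & _).
Qed.

(** An explicit witness instead of a bound by the supremum [da]: witnesses of subterms can be
    combined without approximating. *)
Definition mix_bounds {A} (e : nat -> R) (t : term A nat) (c : R) : Prop :=
  exists l, convex l /\ denot A t (mix l) /\ c <= mix_da l e.

(** The total weight is left as [sumL fst L] instead of 1, since the tail of a list of probabilities
    is no longer normalized. *)
Lemma mix_bounds_list {A} e (L : list (R * term A nat)) (c : R * term A nat -> R) :
  (forall qt, In qt L -> 0 <= fst qt /\ mix_bounds e (snd qt) (c qt)) ->
  exists ps k,
    Forall2 (fun (qP : R * (pm -> Prop)) p => snd qP p)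
      (map (fun qt => (fst qt, denot A (snd qt))) L) ps /\
    (forall wm, In wm k -> 0 <= fst wm) /\ sumL fst k = sumL fst L /\
    (forall m, sumL (fun qp => fst qp * snd qp m)
       (combine (map fst (map (fun qt => (fst qt, denot A (snd qt))) L)) ps) = mix k m) /\
    sumL (fun qt => fst qt * c qt) L <= mix_da k e.
Proof.
  induction L as [|[q t] L IH]; intros H.
  - exists [], []. split; [constructor|]. split; [easy|]. split; [easy|].
    split; [easy|]. unfold mix_da. simpl. lra.
  - destruct IH as (ps & k & F & W & S & M & V); [intros qt Hi; apply H; now right|].
    destruct (H (q, t) (or_introl eq_refl)) as [Hq (l & [Wl Sl] & Hd & Hc)]. simpl in Hq, Hd.
    exists (mix l :: ps), (map (fun wm => (q * fst wm, snd wm)) l ++ k).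
    split; [now constructor|]. split; [|split; [|split]].
    + intros wm Hi. apply in_app_iff in Hi as [Hi|Hi]; [|auto].
      apply in_map_iff in Hi as (z & <- & Hz). simpl. apply Rmult_le_pos; auto.
    + rewrite sumL_app, sumL_map. simpl. rewrite sumL_scal, Sl, S. ring.
    + intros m. unfold mix at 2. rewrite sumL_app, sumL_map. simpl. f_equal; [|apply M].
      unfold mix. rewrite <- sumL_scal. apply sumL_ext. intros; ring.
    + unfold mix_da in *. rewrite sumL_app, sumL_map. simpl. apply Rplus_le_compat; [|easy].
      apply Rle_trans with (q * sumL (fun wm => fst wm * dda (snd wm) e) l).
      * now apply Rmult_le_compat_l.
      * rewrite <- sumL_scal. apply Req_le, sumL_ext. intros; ring.
Qed.

Lemma mix_bounds_subst {A} (d : proc A -> proc A -> R) (s1 s2 : nat -> proc A) (t : term A nat) :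
  is_bisim_metric A d -> (forall x, wf (s1 x)) -> (forall x, wf (s2 x)) -> wf t ->
  mix_bounds (fun x => d (s1 x) (s2 x)) t (d (subst s1 t) (subst s2 t)).
Proof.
  intros HB Hs1 Hs2. set (e := fun x => d (s1 x) (s2 x)).
  assert (He : unit_valued e) by (intros x; now apply HB).
  assert (W1 := fun t => wf_subst s1 t Hs1). assert (W2 := fun t => wf_subst s2 t Hs2).
  induction t as [x| |a L IH|t1 t2 IH1 IH2|B t1 t2 IH1 IH2] using term_list_ind;
    intros Ht; inversion Ht; subst; simpl.
  - exists [(1, mone x)]. split; [apply convex_single|]. split.
    + exists (diracM (mone x)). split; [easy|]. rewrite <- diracM_mix. apply pm_le_refl.
      rewrite diracM_mix. apply is_pm_mix, convex_single.
    + unfold mix_da. simpl. rewrite dda_mone by easy. unfold e. lra.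
  - exists [(1, mzero)]. split; [apply convex_single|]. split; [apply eq_sym, diracM_mix|].
    apply Rle_trans with (1 := bisim_metric_Nil d HB).
    unfold mix_da. simpl. assert (H := dda_unit mzero e He). lra.
  - destruct (mix_bounds_list e L (fun qt => d (subst s1 (snd qt)) (subst s2 (snd qt))))
      as (ps & k & F & Wk & Sk & M & V).
    { intros [q t] Hi. destruct (H2 q t Hi) as [Hq Hw]. simpl. split; [lra|]. now apply (IH q). }
    assert (Ck : convex k) by (split; [easy|now rewrite Sk]).
    exists k. split; [easy|]. split.
    + exists ps. split; [easy|].
      replace (fun m => sumL (fun qp => fst qp * snd qp m) _) with (mix k)
        by (extensionality m; symmetry; apply M).
      now apply pm_le_refl, is_pm_mix.
    + apply Rle_trans with (2 := V).
      apply (bisim_metric_Pref d a L fst (fun qt => subst s1 (snd qt)) (fun qt => subst s2 (snd qt)));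
        try easy.
      intros [q t] Hi. destruct (H2 q t Hi) as [Hq Hw]. simpl. auto.
  - assert (H := bisim_metric_Sum d (subst s1 t1) (subst s1 t2) (subst s2 t1) (subst s2 t2)
      HB ltac:(auto) ltac:(auto) ltac:(auto) ltac:(auto)).
    destruct (IH1 ltac:(easy)) as (l1 & C1 & D1 & V1).
    destruct (IH2 ltac:(easy)) as (l2 & C2 & D2 & V2).
    (* The maximum is one of its two arguments, and the denotation is a union, so the witness of
       that summand serves. *)
    apply Rmax_Rle in H as [H|H].
    + exists l1. split; [easy|]. split; [now left|lra].
    + exists l2. split; [easy|]. split; [now right|lra].
  - destruct (IH1 ltac:(easy)) as (l1 & C1 & D1 & V1).
    destruct (IH2 ltac:(easy)) as (l2 & C2 & D2 & V2).
    exists (mix_par l1 l2). split; [now apply convex_mix_par|]. split.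
    + exists (mix l1), (mix l2). split; [easy|]. split; [easy|].
      rewrite pm_conv_mix by easy. now apply pm_le_refl, is_pm_mix, convex_mix_par.
    + rewrite mix_da_par by easy.
      apply Rle_trans with (1 := bisim_metric_Par d B _ _ _ _ HB
        (W1 t1 ltac:(easy)) (W1 t2 ltac:(easy)) (W2 t1 ltac:(easy)) (W2 t2 ltac:(easy))).
      (* [por] is monotone only as long as its arguments stay at most 1. *)
      assert (Hda : forall l, convex l -> mix_da l e <= 1).
      { intros l Cl. rewrite <- pda_mix by easy. apply pda_le_1; [easy|]. now apply is_pm_mix. }
      apply por_mono; auto; split; try easy; apply HB; auto.
Qed.

Theorem theorem1 (A : Type)
  (HA : exists f : A -> nat, forall a b, f a = f b -> a = b)
  (t : term A nat) (Ht : wf t)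
  (s1 s2 : nat -> proc A)
  (Hs1 : forall x, wf (s1 x)) (Hs2 : forall x, wf (s2 x))
  (d : proc A -> proc A -> R) (Hd : is_bisim_metric A d)
  (Hlt : forall x, d (s1 x) (s2 x) < 1) :
  d (subst s1 t) (subst s2 t) <= da (denot A t) (fun x => d (s1 x) (s2 x)).
Proof.
  set (e := fun x => d (s1 x) (s2 x)).
  assert (He : unit_valued e) by (intros x; now apply Hd).
  destruct (mix_bounds_subst d s1 s2 t Hd Hs1 Hs2 Ht) as (l & Hl & Hden & Hle).
  (* The bound 1 on all discounted activations makes the supremum in [da] a genuine one rather than
     the default 0. *)
  apply Rle_trans with (1 := Hle). apply le_Rsup with 1.
  - intros y (p & Hp & ->). apply pda_le_1; [easy|]. now apply denot_is_pm in Hp.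
  - exists (mix l). split; [easy|]. now rewrite pda_mix.
Qed.
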